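(* Let $h(z)=\sum_{k=0}^{\infty}a_k z^k$ be an analytic function on $|z|<r$ whose Taylor series about $0$ has radius of convergence $r$. Let $f$ be a positive function in the Wiener class on $[-\pi,\pi]$ such that $\frac{f_{\max}^2}{f_{\min}}<r$. For each $n\ge 1$ let $A_n\in\mathbb{C}^{n\times n}$ be the Toeplitz matrix generated by $f$ and let $T_n\in\mathbb{C}^{n\times n}$ be the superoptimal circulant preconditioner for $A_n$. If $\|h(T_n)^{-1}\|_2$ is uniformly bounded with respect to $n$, then for all $\epsilon>0$ there exist positive integers $N$ and $M$ such that for all $n>N$ there are matrices $Q_n,\widetilde R_n,\widetilde E_n\in\mathbb{C}^{n\times n}$ with $$|h(T_n)|^{-1}h(A_n)=Q_n+\widetilde R_n+\widetilde E_n,$$ where $Q_n$ is Hermitian and unitary, $\operatorname{rank}(\widetilde R_n)\le 2M$, and $\|\widetilde E_n\|_2\le\epsilon$.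
   Context: The Fourier coefficients of $f$ on $[-\pi,\pi]$ (extended $2\pi$-periodically) are $\hat f_k=\frac{1}{2\pi}\int_{-\pi}^{\pi}f(x)e^{-\mathbf{i}kx}\,dx$, $k\in\mathbb{Z}$. The function $f$ is in the Wiener class if $\sum_{k\in\mathbb{Z}}|\hat f_k|<\infty$ (so $f$ is continuous and equals the sum of its Fourier series). ''Positive'' means real-valued with $f(x)>0$ for all $x$; $f_{\max}$ and $f_{\min}$ are the maximum and minimum of $f$. The Toeplitz matrix generated by $f$ is $A_n=[\hat f_{j-k}]_{j,k=0}^{n-1}$; it is Hermitian positive definite for all $n$. The Fourier matrix $U_n\in\mathbb{C}^{n\times n}$ has entries $[U_n]_{jk}=\frac{1}{\sqrt n}e^{-2\pi\mathbf{i}jk/n}$, $0\le j,k\le n-1$. The set of circulant matrices is $\mathcal{M}_{U_n}=\{U_n^*\Lambda_nU_n : \Lambda_n \text{ an } n\times n \text{ complex diagonal matrix}\}$. The superoptimal circulant preconditioner $T_n$ for $A_n$ is the minimizer of $\|I_n-C_n^{-1}A_n\|_F$ over all nonsingular $C_n\in\mathcal{M}_{U_n}$, where $\|\cdot\|_F$ is the Frobenius norm. Matrix functions are defined by the power series: $h(X)=\sum_{k=0}^\infty a_kX^k$ for a matrix $X$ of spectral radius less than $r$; here $r\in(0,\infty]$. For a circulant $C_n=U_n^*\Omega_nU_n$ ($\Omega_n$ diagonal), the absolute value circulant matrix is $|C_n|=(C_n^*C_n)^{1/2}=U_n^*|\Omega_n|U_n$, where $|\Omega_n|$ is $\Omega_n$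 with every entry replaced by its modulus; thus $|h(T_n)|=U_n^*|h(\Lambda_n)|U_n$ when $T_n=U_n^*\Lambda_nU_n$. $\|\cdot\|_2$ is the spectral norm. Uniform boundedness of $\|h(T_n)^{-1}\|_2$ means $h(T_n)$ is nonsingular for every $n$ and there is a constant $c_0$ independent of $n$ with $\|h(T_n)^{-1}\|_2<c_0$.
   Formalization: The Taylor coefficients a_k of h are assumed real; without this the claim fails, e.g. for h = i and f = 1, where |h(T_n)|^{-1}h(A_n) = iI is not a Hermitian unitary matrix plus bounded rank plus small norm. *)

(* Defs.v *)
From HB Require Import structures.
From mathcomp Require Import all_boot all_order all_algebra.
From mathcomp Require Import complex.
From mathcomp Require Import all_classical all_reals all_analysis.

Set Implicit Arguments.
Unset Strict Implicit.
Unset Printing Implicit Defensive.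

Import Order.TTheory GRing.Theory Num.Theory numFieldNormedType.Exports.

Local Open Scope classical_set_scope.
Local Open Scope complex_scope.
Local Open Scope sesquilinear_scope.
Local Open Scope ring_scope.

(* R[i] itself carries no topology; seen as a numClosedFieldType it inherits
   the norm topology that exists on every numFieldType, and so do matrices. *)
Definition Cplx (R : realType) : numClosedFieldType := R[i].

Section Definitions.
Context {R : realType}.
Local Notation C := (Cplx R).

(* The modulus as an element of R: `|z| lives in R[i]. *)
Definition cabs (z : C) : R := complex.Re `|z|.

Definition cis (t : R) : C := cos t +i* sin t.

Definition cintegral (D : set R) (F : R -> C) : C :=
  (\int[lebesgue_measure]_(x in D) complex.Re (F x)) +i*
  (\int[lebesgue_measure]_(x in D) complex.Im (F x)).

Definition fourier (f : R -> R) (k : int) : C :=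
  ((2 * pi)^-1)%:C *
  cintegral `[- pi, pi] (fun x => (f x)%:C * cis (- (k%:~R * x))).

(* f is the periodic extension. Continuity selects the representative that is
   the sum of its Fourier series: the coefficients alone only determine f
   almost everywhere. *)
Definition wiener (f : R -> R) : Prop :=
  [/\ continuous f,
      forall x, f (x + 2 * pi) = f x
    & (\esum_(k in [set: int]) (cabs (fourier f k))%:E < +oo)%E].

Definition is_maximum (f : R -> R) (M : R) : Prop :=
  (exists x, f x = M) /\ forall x, f x <= M.

Definition is_minimum (f : R -> R) (m : R) : Prop :=
  (exists x, f x = m) /\ forall x, m <= f x.

Definition conv_radius (a : nat -> C) : \bar R :=
  ereal_sup
    [set (cabs z)%:E | z in [set z | cvgn (series (fun k => a k * z ^+ k))]].

(* h(X) for h = \sum_k a_k z^k; meaningful when the series converges, in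
   particular when the spectral radius of X is below conv_radius a. *)
Definition mxfun (a : nat -> C) n (X : 'M[C]_n) : 'M[C]_n :=
  limn (series (fun k => a k *: X ^+ k)).

Definition frobenius_norm m n (A : 'M[C]_(m, n)) : R :=
  Num.sqrt (\sum_i \sum_j cabs (A i j) ^+ 2).

Definition l2_norm n (x : 'cV[C]_n) : R :=
  Num.sqrt (\sum_i cabs (x i ord0) ^+ 2).

Definition spectral_norm m n (A : 'M[C]_(m, n)) : R :=
  sup [set l2_norm (A *m x) | x in [set x : 'cV[C]_n | l2_norm x <= 1]].

Definition toeplitz (f : R -> R) n : 'M[C]_n :=
  \matrix_(j < n, k < n) fourier f (j%:Z - k%:Z).

Definition fourier_mx n : 'M[C]_n :=
  \matrix_(j < n, k < n)
    (((Num.sqrt n%:R)^-1)%:C * cis (- (2 * pi * j%:R * k%:R / n%:R))).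

Definition circulant n : set 'M[C]_n :=
  [set C0 | exists w : 'rV[C]_n,
    C0 = (fourier_mx n) ^t* *m diag_mx w *m fourier_mx n].

Definition superoptimal n (A T : 'M[C]_n) : Prop :=
  [/\ circulant T, T \in unitmx
    & forall C0, circulant C0 -> C0 \in unitmx ->
        frobenius_norm (1%:M - invmx T *m A) <=
        frobenius_norm (1%:M - invmx C0 *m A)].

(* For C0 = U^* W U with U the (unitary) Fourier matrix and W diagonal,
   W = U C0 U^*, so this is U^* |W| U. *)
Definition circ_abs n (C0 : 'M[C]_n) : 'M[C]_n :=
  let U := fourier_mx n in
  U ^t* *m diag_mx (\row_j `|(U *m C0 *m U ^t*) j j|) *m U.

End Definitions.

(* Main.v *)
Require Import Defs.
From HB Require Import structures.
From mathcomp Require Import all_boot all_order all_algebra.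
From mathcomp Require Import complex.
From mathcomp Require Import all_classical all_reals all_analysis.
From mathcomp Require Import ring lra zify.

Set Implicit Arguments.
Unset Strict Implicit.
Unset Printing Implicit Defensive.

Import Order.TTheory GRing.Theory Num.Theory numFieldNormedType.Exports.

Local Open Scope classical_set_scope.
Local Open Scope complex_scope.
Local Open Scope sesquilinear_scope.
Local Open Scope ring_scope.

(** Write A for the n x n Toeplitz matrix of f, T for its superoptimal
    circulant preconditioner, U for the Fourier matrix and B = U A U^*.

    The quadratic form of A is the average over a period of f |p|^2, where p is
    the trigonometric polynomial whose coefficients are the given vector.  It
    therefore lies between fmin |x|^2 and fmax |x|^2 ([toeplitz_form_ge],
    [toeplitz_form_le]), and A has operator norm at most fmax
    ([opbound_toeplitz]).  In the Fourier basis the Frobenius functional that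
    defines T is a sum of one quadratic function per row, so the minimizer is
    explicit ([superoptimal_udiag]): T = U^* diag(lambda) U with
    lambda_i = (sum_j |B_ij|^2) / B_ii, a real number between 0 and
    rho = fmax^2 / fmin.  Thus A and T are bounded by rho, which is smaller than
    the radius of convergence of h, uniformly in n.

    The heart of the matter is that A - T is, for n large, a matrix of bounded
    rank plus a matrix of small operator norm ([toeplitz_lowrank_near]).
    Truncating the Fourier series of f changes A by little, by summability of
    the coefficients; the truncated Toeplitz matrix agrees with a circulant
    U^* diag(s) U except in two corners of fixed size ([toeplitz_split]).  If
    v_i bounds the norm of the i-th column of the resulting perturbation of
    diag(s), then |s_i - lambda_i| <= v_i + v_i^2 / fmin
    ([superoptimal_symbol_close]).  The Frobenius norm of the corner part does
    not grow with n, so all but a bounded number of the v_i are small, and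
    diag(s - lambda) is itself of bounded rank up to a small error.

    Finally h is a limit of polynomials, with a truncation error on matrices
    bounded by rho that does not depend on the dimension
    ([mxfun_truncation]), and a polynomial in A minus the same polynomial in T
    inherits the decomposition from A - T ([lowrank_nearX]).  So
    h(A) - h(T) has bounded rank up to a small error as well
    ([mxfun_lowrank_near]).  The coefficients of h and the lambda_i are real,
    hence h(T) = U^* diag(g) U with g real ([mxfun_rudiag]), and
    Q = |h(T)|^-1 h(T) = U^* diag(sgn g) U is Hermitian and unitary.  Since
    |h(T)|^-1 is bounded by hypothesis,
    |h(T)|^-1 h(A) = Q + |h(T)|^-1 (h(A) - h(T)) has the required form. *)

(** * The modulus as a real number *)

Section Modulus.
Context {R : realType}.
Local Notation C := (Cplx R).
Implicit Types (z w : C) (x y : R).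

(** The canonical embedding of R, typed in Cplx R rather than in R[i] so that
    the theory of numeric closed fields applies to its values. *)
Definition rc (x : R) : C := x%:C.

Lemma rc_is_additive : additive rc.
Proof. exact: rmorphB. Qed.
Lemma rc_is_multiplicative : multiplicative rc.
Proof. by split; [exact: rmorphM | exact: rmorph1]. Qed.
HB.instance Definition _ := GRing.isAdditive.Build R C rc rc_is_additive.
HB.instance Definition _ := GRing.isMultiplicative.Build R C rc rc_is_multiplicative.

Lemma normcR z : `|z| = rc (cabs z).
Proof. by rewrite /cabs /rc RRe_real ?normr_real. Qed.

Lemma rc_inj : injective rc. Proof. exact: complexI. Qed.
Lemma rc_le x y : (rc x <= rc y) = (x <= y). Proof. exact: lecR. Qed.
Lemma rc_lt x y : (rc x < rc y) = (x < y). Proof. exact: ltcR. Qed.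
Lemma rc_real x : rc x \is Num.real. Proof. by apply/complex_realP; exists x. Qed.
Lemma conj_rc x : (rc x)^* = rc x. Proof. by rewrite (CrealP (rc_real x)). Qed.
Lemma cabs_ge0 z : 0 <= cabs z.
Proof. by rewrite -rc_le -normcR normr_ge0. Qed.
Lemma cabsM z w : cabs (z * w) = cabs z * cabs w.
Proof. by apply: rc_inj; rewrite rmorphM /= -!normcR normrM. Qed.
Lemma cabsD z w : cabs (z + w) <= cabs z + cabs w.
Proof. by rewrite -rc_le rmorphD /= -!normcR ler_normD. Qed.
Lemma cabsN z : cabs (- z) = cabs z.
Proof. by rewrite /cabs normrN. Qed.
Lemma cabs0 : cabs (0 : C) = 0.
Proof. by apply: rc_inj; rewrite -normcR normr0 rmorph0. Qed.
Lemma cabs1 : cabs (1 : C) = 1.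
Proof. by apply: rc_inj; rewrite -normcR normr1 rmorph1. Qed.
Lemma cabs_rc x : cabs (rc x) = `|x|.
Proof. by rewrite /cabs normc_def /= expr0n /= addr0 sqrtr_sqr. Qed.
Lemma cabsJ z : cabs (z^*) = cabs z.
Proof. by rewrite /cabs norm_conjC. Qed.
Lemma cabsX z n : cabs (z ^+ n) = cabs z ^+ n.
Proof. by elim: n => [|n IH]; rewrite ?cabs1 // !exprS cabsM IH. Qed.
Lemma cabs_eq0 z : (cabs z == 0) = (z == 0).
Proof. by rewrite -(inj_eq rc_inj) -normcR rmorph0 normr_eq0. Qed.
Lemma cabs_sqr z : z * z^* = rc (cabs z ^+ 2).
Proof. by rewrite rmorphXn /= -normcR normCK. Qed.
Lemma cabs_ReIm z : cabs z ^+ 2 = complex.Re z ^+ 2 + complex.Im z ^+ 2.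
Proof. by apply: rc_inj; rewrite rmorphXn /= -normcR -add_Re2_Im2. Qed.
Lemma Re_le_cabs z : `|complex.Re z| <= cabs z.
Proof.
rewrite -(ler_pXn2r (n := 2)) ?nnegrE ?cabs_ge0 // cabs_ReIm real_normK ?num_real //.
by rewrite lerDl sqr_ge0.
Qed.
Lemma Im_le_cabs z : `|complex.Im z| <= cabs z.
Proof.
rewrite -(ler_pXn2r (n := 2)) ?nnegrE ?cabs_ge0 // cabs_ReIm real_normK ?num_real //.
by rewrite lerDr sqr_ge0.
Qed.
Lemma cabs_le_ReIm z : cabs z <= `|complex.Re z| + `|complex.Im z|.
Proof.
rewrite -(ler_pXn2r (n := 2)) ?nnegrE ?cabs_ge0 ?addr_ge0 // cabs_ReIm sqrrD.
rewrite !real_normK ?num_real //.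
have : 0 <= `|complex.Re z| * `|complex.Im z| by rewrite mulr_ge0.
by lra.
Qed.
Lemma cabs_sum (I : Type) (r : seq I) (P : pred I) (F : I -> C) :
  cabs (\sum_(i <- r | P i) F i) <= \sum_(i <- r | P i) cabs (F i).
Proof.
elim/big_rec2: _ => [|i y z _ le]; first by rewrite cabs0.
by apply: le_trans (cabsD _ _) _; rewrite lerD2l.
Qed.
Lemma cReD z w : complex.Re (z + w) = complex.Re z + complex.Re w.
Proof. by case: z w => [a b] [c d]. Qed.
Lemma cImD z w : complex.Im (z + w) = complex.Im z + complex.Im w.
Proof. by case: z w => [a b] [c d]. Qed.
Lemma cReM z w : complex.Re (z * w) = complex.Re z * complex.Re w - complex.Im z * complex.Im w.
Proof. by case: z w => [a b] [c d]. Qed.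
Lemma cImM z w : complex.Im (z * w) = complex.Re z * complex.Im w + complex.Im z * complex.Re w.
Proof. by case: z w => [a b] [c d]. Qed.
Lemma cImJ z : complex.Im (z^*) = - complex.Im z.
Proof. by case: z. Qed.
Lemma cImN z : complex.Im (- z) = - complex.Im z.
Proof. by case: z. Qed.
Lemma cReJ z : complex.Re (z^*) = complex.Re z.
Proof. by case: z. Qed.
End Modulus.

(** * The Euclidean norm and operator bounds *)

Section FiniteSums.
Context {R : realType}.
Implicit Types (I : finType).

Lemma cauchy_schwarz_weighted I (p y : I -> R) : (forall i, 0 <= p i) ->
  (\sum_i p i * y i) ^+ 2 <= (\sum_i p i) * (\sum_i p i * y i ^+ 2).
Proof.
move=> p0.
have : 0 <= \sum_i \sum_j p i * p j * (y i - y j) ^+ 2.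
  by apply: sumr_ge0 => i _; apply: sumr_ge0 => j _; rewrite mulr_ge0 ?sqr_ge0 // mulr_ge0.
have -> : \sum_i \sum_j p i * p j * (y i - y j) ^+ 2 =
  2 * ((\sum_i p i) * (\sum_i p i * y i ^+ 2) - (\sum_i p i * y i) ^+ 2).
  have -> : \sum_i \sum_j p i * p j * (y i - y j) ^+ 2 =
    \sum_i \sum_j (p i * (p j * y j ^+ 2)) + \sum_i \sum_j (p i * y i ^+ 2 * p j)
    - 2 * \sum_i \sum_j (p i * y i * (p j * y j)).
    rewrite mulr_sumr -!big_split /= -sumrB; apply: eq_bigr => i _.
    rewrite mulr_sumr -!big_split /= -sumrB; apply: eq_bigr => j _.
    by ring.
  by rewrite -!big_distrlr /=; ring.
by rewrite pmulr_rge0 // subr_ge0.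
Qed.

Lemma cauchy_schwarz_sum I (x y : I -> R) :
  (\sum_i x i * y i) ^+ 2 <= (\sum_i x i ^+ 2) * (\sum_i y i ^+ 2).
Proof.
have : 0 <= \sum_i \sum_j (x i * y j - x j * y i) ^+ 2.
  by apply: sumr_ge0 => i _; apply: sumr_ge0 => j _; rewrite sqr_ge0.
have -> : \sum_i \sum_j (x i * y j - x j * y i) ^+ 2 =
  2 * ((\sum_i x i ^+ 2) * (\sum_i y i ^+ 2) - (\sum_i x i * y i) ^+ 2).
  have -> : \sum_i \sum_j (x i * y j - x j * y i) ^+ 2 =
    \sum_i \sum_j (x i ^+ 2 * y j ^+ 2) + \sum_i \sum_j (y i ^+ 2 * x j ^+ 2)
    - 2 * \sum_i \sum_j (x i * y i * (x j * y j)).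
    rewrite mulr_sumr -!big_split /= -sumrB; apply: eq_bigr => i _.
    rewrite mulr_sumr -!big_split /= -sumrB; apply: eq_bigr => j _.
    by ring.
  by rewrite -!big_distrlr /=; ring.
by rewrite pmulr_rge0 // subr_ge0.
Qed.
End FiniteSums.

Section EuclideanNorm.
Context {R : realType}.
Local Notation C := (Cplx R).

Lemma l2_norm_ge0 n (x : 'cV[C]_n) : 0 <= l2_norm x.
Proof. exact: sqrtr_ge0. Qed.

Lemma l2_norm_sqr n (x : 'cV[C]_n) : l2_norm x ^+ 2 = \sum_i cabs (x i ord0) ^+ 2.
Proof. by rewrite sqr_sqrtr // sumr_ge0 // => i _; rewrite sqr_ge0. Qed.

Lemma l2_norm_le n (x : 'cV[C]_n) (c : R) : 0 <= c ->
  (l2_norm x <= c) = (l2_norm x ^+ 2 <= c ^+ 2).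
Proof. by move=> c0; rewrite ler_pXn2r ?nnegrE ?l2_norm_ge0. Qed.

Lemma l2_norm0 n : l2_norm (0 : 'cV[C]_n) = 0.
Proof.
apply/eqP; rewrite eq_le l2_norm_ge0 andbT l2_norm_le // l2_norm_sqr expr0n /=.
by rewrite big1 // => i _; rewrite mxE cabs0 expr0n.
Qed.

Lemma l2_normZ n (z : C) (x : 'cV[C]_n) : l2_norm (z *: x) = cabs z * l2_norm x.
Proof.
apply/eqP; rewrite -(eqrXn2 (n := 2)) ?mulr_ge0 ?l2_norm_ge0 ?cabs_ge0 //.
rewrite exprMn !l2_norm_sqr mulr_sumr; apply/eqP; apply: eq_bigr => i _.
by rewrite mxE cabsM exprMn.
Qed.

Lemma l2_normD n (x y : 'cV[C]_n) : l2_norm (x + y) <= l2_norm x + l2_norm y.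
Proof.
rewrite l2_norm_le ?addr_ge0 ?l2_norm_ge0 //.
have le1 : l2_norm (x + y) ^+ 2 <=
    \sum_i (cabs (x i ord0) + cabs (y i ord0)) ^+ 2.
  rewrite l2_norm_sqr; apply: ler_sum => i _; rewrite mxE.
  by rewrite ler_pXn2r ?nnegrE ?addr_ge0 ?cabs_ge0 ?cabsD.
apply: le_trans le1 _.
under eq_bigr do rewrite sqrrD.
rewrite !big_split /= -!l2_norm_sqr sqrrD lerD2r lerD2l -mulr2n lerMn2r /=.
rewrite -(ler_pXn2r (n := 2)) ?nnegrE ?mulr_ge0 ?l2_norm_ge0 //; last first.
  by apply: sumr_ge0 => i _; rewrite mulr_ge0 ?cabs_ge0.
rewrite exprMn !l2_norm_sqr.
exact: (cauchy_schwarz_sum (fun i => cabs (x i ord0)) (fun i => cabs (y i ord0))).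
Qed.

Lemma cabs_le_l2_norm n (x : 'cV[C]_n) i : cabs (x i ord0) <= l2_norm x.
Proof.
rewrite -(ler_pXn2r (n := 2)) ?nnegrE ?cabs_ge0 ?l2_norm_ge0 // l2_norm_sqr.
by rewrite (bigD1 i) //= lerDl sumr_ge0 // => j _; rewrite sqr_ge0.
Qed.

Lemma l2_norm_delta n (i : 'I_n) : l2_norm (delta_mx i ord0 : 'cV[C]_n) = 1.
Proof.
apply/eqP; rewrite -(eqrXn2 (n := 2)) ?l2_norm_ge0 // l2_norm_sqr expr1n.
rewrite (bigD1 i) //= big1 => [|j ji]; rewrite !mxE ?eqxx ?(negPf ji) ?cabs0 ?expr0n //=.
by rewrite cabs1 expr1n addr0.
Qed.

Lemma l2_norm_sqr_dot n (x : 'cV[C]_n) :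
  (x^t* *m x) ord0 ord0 = rc (l2_norm x ^+ 2).
Proof.
rewrite l2_norm_sqr rmorph_sum mxE; apply: eq_bigr => i _.
by rewrite !mxE mulrC cabs_sqr.
Qed.
End EuclideanNorm.

Section OperatorBounds.
Context {R : realType}.
Local Notation C := (Cplx R).

(** The spectral norm is a supremum and awkward to estimate; all estimates are
    carried out with this relation and converted at both ends by
    [spectral_norm_le] and [le_spectral_norm]. *)
Definition opbound m n (A : 'M[C]_(m, n)) (c : R) : Prop :=
  forall x : 'cV[C]_n, l2_norm (A *m x) <= c * l2_norm x.

Lemma opbound_le m n (A : 'M[C]_(m, n)) c d : c <= d -> opbound A c -> opbound A d.
Proof.
by move=> cd Ac x; apply: le_trans (Ac x) _; rewrite ler_wpM2r ?l2_norm_ge0.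
Qed.

Lemma opboundD m n (A B : 'M[C]_(m, n)) c d :
  opbound A c -> opbound B d -> opbound (A + B) (c + d).
Proof.
move=> Ac Bd x; rewrite mulmxDl mulrDl.
by apply: le_trans (l2_normD _ _) _; rewrite lerD.
Qed.

Lemma opboundZ m n (A : 'M[C]_(m, n)) z c :
  opbound A c -> opbound (z *: A) (cabs z * c).
Proof.
by move=> Ac x; rewrite -scalemxAl l2_normZ -mulrA ler_wpM2l ?cabs_ge0.
Qed.

Lemma opboundN m n (A : 'M[C]_(m, n)) c : opbound A c -> opbound (- A) c.
Proof. by move/(opboundZ (-1)); rewrite scaleN1r cabsN cabs1 mul1r. Qed.

Lemma opboundM m n p (A : 'M[C]_(m, n)) (B : 'M[C]_(n, p)) c d : 0 <= c ->
  opbound A c -> opbound B d -> opbound (A *m B) (c * d).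
Proof.
move=> c0 Ac Bd x; rewrite -mulmxA -mulrA.
by apply: le_trans (Ac _) _; rewrite ler_wpM2l.
Qed.

Lemma opbound0 m n : opbound (0 : 'M[C]_(m, n)) 0.
Proof. by move=> x; rewrite mul0mx l2_norm0 mul0r. Qed.

Lemma opbound1 n : opbound (1%:M : 'M[C]_n) 1.
Proof. by move=> x; rewrite mul1mx mul1r. Qed.

Lemma opboundX n (A : 'M[C]_n) c k : 0 <= c -> opbound A c -> opbound (A ^+ k) (c ^+ k).
Proof.
move=> c0 Ac; elim: k => [|k IH]; first by rewrite !expr0; exact: opbound1.
by rewrite !exprS; apply: opboundM.
Qed.

Lemma opbound_sum m n (I : Type) (r : seq I) (P : pred I) (A : I -> 'M[C]_(m, n)) c :
  (forall i, P i -> opbound (A i) (c i)) ->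
  opbound (\sum_(i <- r | P i) A i) (\sum_(i <- r | P i) c i).
Proof.
move=> Ac; elim/big_rec2: _ => [|i y z Pi le]; first exact: opbound0.
by apply: opboundD => //; exact: Ac.
Qed.

Lemma l2_norm_unitary n (U : 'M[C]_n) : U^t* *m U = 1%:M ->
  forall x : 'cV[C]_n, l2_norm (U *m x) = l2_norm x.
Proof.
move=> UU x; apply/eqP; rewrite -(eqrXn2 (n := 2)) ?l2_norm_ge0 //.
apply/eqP/rc_inj; rewrite -!l2_norm_sqr_dot trmx_mul map_mxM mulmxA.
by rewrite -(mulmxA _ _ U) UU mulmx1.
Qed.

Lemma cabs_entry_le m n (A : 'M[C]_(m, n)) c i j : opbound A c -> cabs (A i j) <= c.
Proof.
move=> /(_ (delta_mx j ord0)); rewrite l2_norm_delta mulr1; apply: le_trans.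
suff -> : A i j = (A *m (delta_mx j ord0 : 'cV_n)) i ord0 by exact: cabs_le_l2_norm.
transitivity (col j A i ord0); first by rewrite mxE.
exact: (congr1 (fun M : 'cV_m => M i ord0) (colE j A)).
Qed.

(** Schur's test: the Cauchy-Schwarz inequality with weights |A i j| bounds the
    square of the i-th entry of A x by c * sum_j |A i j| |x j|^2, and summing
    over i uses the column bound. *)
Lemma opbound_schur m n (A : 'M[C]_(m, n)) (c : R) : 0 <= c ->
  (forall i, \sum_j cabs (A i j) <= c) -> (forall j, \sum_i cabs (A i j) <= c) ->
  opbound A c.
Proof.
move=> c0 Ar Ac x; rewrite l2_norm_le ?mulr_ge0 ?l2_norm_ge0 // l2_norm_sqr.
have row i : cabs ((A *m x) i ord0) ^+ 2 <= c * \sum_j cabs (A i j) * cabs (x j ord0) ^+ 2.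
  have le1 : cabs ((A *m x) i ord0) <= \sum_j cabs (A i j) * cabs (x j ord0).
    by rewrite mxE; apply: le_trans (cabs_sum _ _ _) _; apply: ler_sum => j _; rewrite cabsM.
  have sq := cauchy_schwarz_weighted (p := fun j => cabs (A i j))
    (fun j => cabs (x j ord0)) (fun j => cabs_ge0 _).
  apply: le_trans (le_trans sq _); last first.
    rewrite ler_wpM2r // sumr_ge0 // => j _.
    by rewrite mulr_ge0 ?sqr_ge0 ?cabs_ge0.
  rewrite ler_pXn2r ?nnegrE ?cabs_ge0 // sumr_ge0 // => j _.
  by rewrite mulr_ge0 ?cabs_ge0.
apply: le_trans (ler_sum _ (fun i _ => row i)) _.
rewrite -mulr_sumr exchange_big /= exprMn expr2 -mulrA ler_wpM2l // l2_norm_sqr mulr_sumr.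
by apply: ler_sum => j _; rewrite -mulr_suml ler_wpM2r ?sqr_ge0.
Qed.

Lemma opbound_diag n (w : 'rV[C]_n) c : 0 <= c ->
  (forall i, cabs (w ord0 i) <= c) -> opbound (diag_mx w) c.
Proof.
move=> c0 wc; apply: opbound_schur => // i; rewrite (bigD1 i) //= big1 ?addr0.
- by rewrite mxE eqxx mulr1n.
- by move=> j ji; rewrite mxE eq_sym (negPf ji) mulr0n cabs0.
- by rewrite mxE eqxx mulr1n.
- by move=> j ji; rewrite mxE (negPf ji) mulr0n cabs0.
Qed.

Lemma opbound_entries n (A : 'M[C]_n) (e : R) :
  0 <= e -> (forall i j, cabs (A i j) <= e) -> opbound A (n%:R * e).
Proof.
move=> e0 Ae; have sum_le (F : 'I_n -> R) : (forall i, F i <= e) ->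
    \sum_i F i <= n%:R * e.
  move=> Fe; apply: le_trans (ler_sum _ (fun i _ => Fe i)) _.
  by rewrite sumr_const card_ord mulr_natl.
by apply: opbound_schur => [|i|j]; rewrite ?mulr_ge0 //; apply: sum_le.
Qed.

Lemma spectral_norm_le n (A : 'M[C]_n) (c : R) : 0 <= c -> opbound A c ->
  spectral_norm A <= c.
Proof.
move=> c0 Ac; apply: ge_sup.
  by exists (l2_norm (A *m (0 : 'cV_n))), 0 => //=; rewrite l2_norm0.
move=> _ [x /= x1 <-]; apply: le_trans (Ac x) _.
by rewrite ler_piMr.
Qed.

(** The supremum is finite because the moduli of the entries bound all the
    values over the unit ball. *)
Lemma le_spectral_norm n (A : 'M[C]_n) (x : 'cV[C]_n) : l2_norm x <= 1 ->
  l2_norm (A *m x) <= spectral_norm A.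
Proof.
move=> x1; apply: ub_le_sup; last by exists x.
pose e := \sum_i \sum_j cabs (A i j).
have e0 : 0 <= e by apply: sumr_ge0 => i _; apply: sumr_ge0 => j _; exact: cabs_ge0.
have Ae : opbound A (n%:R * e).
  apply: opbound_entries => // i j; rewrite /e (bigD1 i) //= (bigD1 j) //=.
  rewrite -addrA lerDl addr_ge0 ?sumr_ge0 // => k _; rewrite ?cabs_ge0 //.
  by rewrite sumr_ge0 // => l _; rewrite cabs_ge0.
exists (n%:R * e) => _ [y /= y1 <-]; apply: le_trans (Ae y) _.
by rewrite ler_piMr // mulr_ge0.
Qed.
End OperatorBounds.

(** * Low rank plus small norm *)

Section LowRankPlusSmall.
Context {R : realType}.
Local Notation C := (Cplx R).

Lemma mxrank_sum_le m n (I : Type) (r : seq I) (P : pred I) (A : I -> 'M[C]_(m, n)) (k : I -> nat) :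
  (forall i, P i -> (\rank (A i) <= k i)%N) ->
  (\rank (\sum_(i <- r | P i) A i)%R <= \sum_(i <- r | P i) k i)%N.
Proof.
move=> Ak; elim/big_rec2: _ => [|i y z Pi le]; first by rewrite mxrank0.
by apply: leq_trans (mxrank_add _ _) _; rewrite leq_add // Ak.
Qed.

Lemma mxrank_row_support m n (A : 'M[C]_(m, n)) (J : {set 'I_m}) :
  (forall i j, i \notin J -> A i j = 0) -> (\rank A <= #|J|)%N.
Proof.
move=> A0.
have -> : A = \sum_(i in J) (delta_mx i ord0 : 'cV_m) *m row i A.
  apply/matrixP => i j; rewrite summxE.
  under eq_bigr do rewrite mxE big_ord1 !mxE eqxx andbT.
  have [iJ|iJ] := boolP (i \in J).
    rewrite (bigD1 i) //= eqxx mul1r big1 ?addr0 // => k /andP[_ ki].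
    by rewrite eq_sym (negPf ki) mul0r.
  rewrite A0 // big1 // => k kJ; case: eqP => [ik|_]; last by rewrite mul0r.
  by rewrite ik kJ in iJ.
rewrite -sum1_card; apply: mxrank_sum_le => i _.
by apply: leq_trans (mxrankM_maxl _ _) (rank_leq_col _).
Qed.

Definition lowrank_near m n (X : 'M[C]_(m, n)) (k : nat) (e : R) : Prop :=
  exists Rn E, [/\ X = Rn + E, (\rank Rn <= k)%N & opbound E e].

Lemma lowrank_near_le m n (X : 'M[C]_(m, n)) k k' e e' : (k <= k')%N -> e <= e' ->
  lowrank_near X k e -> lowrank_near X k' e'.
Proof.
move=> kk ee [Rn [E [-> rk Ee]]]; exists Rn, E; split=> //.
  exact: leq_trans kk.
exact: opbound_le Ee.
Qed.

Lemma lowrank_near_small m n (X : 'M[C]_(m, n)) e : opbound X e -> lowrank_near X 0 e.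
Proof. by move=> Xe; exists 0, X; rewrite add0r mxrank0. Qed.

Lemma lowrank_nearD m n (X Y : 'M[C]_(m, n)) k l e d :
  lowrank_near X k e -> lowrank_near Y l d -> lowrank_near (X + Y) (k + l) (e + d).
Proof.
move=> [Rx [Ex [-> rx ex]]] [Ry [Ey [-> ry ey]]].
exists (Rx + Ry), (Ex + Ey); split; first by rewrite addrACA.
  by apply: leq_trans (mxrank_add _ _) _; rewrite leq_add.
exact: opboundD.
Qed.

Lemma lowrank_nearMl m n p (B : 'M[C]_(m, n)) (X : 'M[C]_(n, p)) k e c : 0 <= c ->
  opbound B c -> lowrank_near X k e -> lowrank_near (B *m X) k (c * e).
Proof.
move=> c0 Bc [Rx [Ex [-> rx ex]]]; exists (B *m Rx), (B *m Ex).
by split; [rewrite mulmxDr | apply: leq_trans (mxrankM_maxr _ _) _ | exact: opboundM].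
Qed.

Lemma lowrank_nearMr m n p (X : 'M[C]_(m, n)) (B : 'M[C]_(n, p)) k e c : 0 <= e ->
  opbound B c -> lowrank_near X k e -> lowrank_near (X *m B) k (e * c).
Proof.
move=> c0 Bc [Rx [Ex [-> rx ex]]]; exists (Rx *m B), (Ex *m B).
by split; [rewrite mulmxDl | apply: leq_trans (mxrankM_maxl _ _) _ | exact: opboundM].
Qed.

Lemma lowrank_nearZ m n (X : 'M[C]_(m, n)) z k e :
  lowrank_near X k e -> lowrank_near (z *: X) k (cabs z * e).
Proof.
move=> [Rx [Ex [-> rx ex]]]; exists (z *: Rx), (z *: Ex).
by split; [rewrite scalerDr | apply: leq_trans (mxrank_scale _ _) _ | exact: opboundZ].
Qed.

Lemma lowrank_near_sum m n (I : Type) (r : seq I) (P : pred I) (X : I -> 'M[C]_(m, n)) k e :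
  (forall i, P i -> lowrank_near (X i) (k i) (e i)) ->
  lowrank_near (\sum_(i <- r | P i) X i) (\sum_(i <- r | P i) k i) (\sum_(i <- r | P i) e i).
Proof.
move=> Xke; elim: r => [|i r IH]; first by rewrite !big_nil; apply/lowrank_near_small/opbound0.
by rewrite !big_cons; case: ifP => // Pi; apply: lowrank_nearD => //; exact: Xke.
Qed.

(** Induction on A^(m+1) - T^(m+1) = A (A^m - T^m) + (A - T) T^m. *)
Lemma lowrank_nearX n (A T : 'M[C]_n) c k e m : 0 <= c -> 0 <= e ->
  opbound A c -> opbound T c -> lowrank_near (A - T) k e ->
  lowrank_near (A ^+ m - T ^+ m) (m * k) (m%:R * c ^+ m.-1 * e).
Proof.
move=> c0 e0 Ac Tc AT; elim: m => [|m IH].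
  by rewrite subrr !mul0r; apply/lowrank_near_small/opbound0.
have -> : A ^+ m.+1 - T ^+ m.+1 = A *m (A ^+ m - T ^+ m) + (A - T) *m T ^+ m.
  by rewrite mulmxBr mulmxBl addrA subrK !exprS.
have -> : m.+1%:R * c ^+ m.+1.-1 * e = c * (m%:R * c ^+ m.-1 * e) + e * c ^+ m.
  case: m {IH} => [|m]; first by rewrite /= !expr0; ring.
  by rewrite /= exprS -[m.+2%:R]natr1; ring.
rewrite mulSn addnC; apply: lowrank_nearD; first exact: lowrank_nearMl.
by apply: lowrank_nearMr => //; exact: opboundX.
Qed.
End LowRankPlusSmall.

(** * Characters and the Fourier matrix *)

Section Cis.
Context {R : realType}.
Local Notation C := (Cplx R).
Implicit Types (s t : R).

Lemma cisD s t : cis (s + t) = cis s * cis t :> C.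
Proof.
rewrite /cis cosD sinD.
transitivity ((cos s * cos t - sin s * sin t) +i* (cos s * sin t + sin s * cos t)) => //.
by rewrite [X in _ +i* X]addrC.
Qed.

Lemma cis0 : cis 0 = 1 :> C.
Proof. by rewrite /cis cos0 sin0. Qed.

Lemma cisJ t : (cis t)^* = cis (- t) :> C.
Proof. by rewrite /cis cosN sinN. Qed.

Lemma cisX t n : cis t ^+ n = cis (n%:R * t) :> C.
Proof.
elim: n => [|n IH]; first by rewrite mul0r cis0.
by rewrite exprS IH -cisD -[n.+1%:R]natr1 mulrDl mul1r addrC.
Qed.

Lemma cis_2pi : cis (2 * pi) = 1 :> C.
Proof. by rewrite /cis mulr_natl cos2pi sin2pi. Qed.

Lemma cis_period (z : int) : cis (2 * pi * z%:~R) = 1 :> C.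
Proof.
case: (intP z) => [|n|n]; first by rewrite mulr0 cis0.
  by rewrite mulrC -[_%:~R]/(n.+1%:R) -cisX cis_2pi expr1n.
by rewrite intrN mulrN -cisJ mulrC -[_%:~R]/(n.+1%:R) -cisX cis_2pi expr1n rmorph1.
Qed.

Lemma cis_neq1 t : 0 < t -> t < 2 * pi -> cis t != 1 :> C.
Proof.
move=> t0 t2; apply/eqP => /(congr1 (@complex.Re R)) /= c1.
have s0 : 0 < sin (t / 2).
  by apply: sin_gt0_pi; rewrite divr_gt0 //= ltr_pdivrMr // mulrC.
have : cos (t / 2 *+ 2) = 1 by rewrite -mulr_natr mulfVK ?pnatr_eq0.
rewrite cos_mulr2n => h.
have := cos2Dsin2 (t / 2) => h2.
have : 0 < sin (t / 2) ^+ 2 by rewrite exprn_gt0.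
by lra.
Qed.

(** Orthogonality of the characters of the cyclic group: a geometric sum whose
    ratio is an n-th root of unity, equal to 1 exactly when n divides q. *)
Lemma sum_cis n (q : int) : (0 < n)%N ->
  \sum_(m < n) cis (2 * pi * m%:R * q%:~R / n%:R) =
  (if (n%:Z %| q)%Z then n%:R else 0) :> C.
Proof.
move=> n0; have nR : n%:R != 0 :> R by rewrite pnatr_eq0 -lt0n.
pose w : C := cis (2 * pi * q%:~R / n%:R).
have -> : \sum_(m < n) cis (2 * pi * m%:R * q%:~R / n%:R) = \sum_(m < n) w ^+ m.
  by apply: eq_bigr => m _; rewrite cisX; congr cis; ring.
have wmod : w = cis (2 * pi * (q %% n%:Z)%Z%:~R / n%:R).
  rewrite /w {1}(divz_eq q n%:Z) -[RHS]mul1r -(cis_period (q %/ n%:Z)%Z) -cisD.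
  by congr cis; rewrite intrD intrM -[n%:Z%:~R]/(n%:R); field.
have qn0 : (0 <= q %% n%:Z)%Z by rewrite modz_ge0 // eqz_nat -lt0n.
have qn1 : (q %% n%:Z < n%:Z)%Z by rewrite ltz_pmod.
case: ifPn => [/dvdz_mod0P qn|qn].
  rewrite wmod qn mulr0 mul0r cis0.
  by under eq_bigr do rewrite expr1n; rewrite sumr_const card_ord.
have w1 : w != 1.
  rewrite wmod; apply: cis_neq1.
    rewrite divr_gt0 ?ltr0n // mulr_gt0 ?mulr_gt0 ?pi_gt0 //.
    by rewrite ltr0z lt_neqAle qn0 andbT eq_sym; apply: contra qn => /eqP/dvdz_mod0P.
  rewrite ltr_pdivrMr ?ltr0n // ltr_pM2l ?mulr_gt0 ?pi_gt0 //.
  by rewrite -[n%:R]/(n%:Z%:~R) ltr_int.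
have wN : w - 1 != 0 by rewrite subr_eq0.
apply: (mulfI wN); rewrite mulr0 -subrX1 /w cisX; apply/eqP; rewrite subr_eq0.
rewrite -(cis_period q); apply/eqP.
by congr cis; field.
Qed.
End Cis.

Section FourierMatrix.
Context {R : realType}.
Local Notation C := (Cplx R).
Local Notation U := (@fourier_mx R).

(** The (j, l) entry depends on j - l only: this is the Fourier inversion that
    turns a circulant into a matrix constant along diagonals. *)
Lemma circulantE n (s : 'rV[C]_n) (j l : 'I_n) :
  ((U n)^t* *m diag_mx s *m U n) j l =
  rc (n%:R^-1) * \sum_m s ord0 m * cis (2 * pi * m%:R * (j%:Z - l%:Z)%:~R / n%:R).
Proof.
rewrite mxE mulr_sumr; apply: eq_bigr => m _.
have -> : cis (2 * pi * m%:R * (j%:Z - l%:Z)%:~R / n%:R) =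
   cis (2 * pi * m%:R * j%:R / n%:R) * cis (- (2 * pi * m%:R * l%:R / n%:R)) :> C.
  by rewrite -cisD; congr cis; rewrite intrB -[j%:Z%:~R]/(j%:R) -[l%:Z%:~R]/(l%:R); ring.
have sq : rc n%:R^-1 = rc (Num.sqrt n%:R)^-1 * rc (Num.sqrt n%:R)^-1 :> C.
  by rewrite -rmorphM /= -invfM -expr2 sqr_sqrtr ?ler0n.
rewrite mul_mx_diag !mxE rmorphM /= -/(rc _) conj_rc cisJ opprK sq.
by ring.
Qed.

Lemma fourier_mxJK n : (0 < n)%N -> (U n)^t* *m U n = 1%:M.
Proof.
move=> n0; have -> : (U n)^t* *m U n = (U n)^t* *m diag_mx (const_mx 1) *m U n.
  by rewrite diag_const_mx mulmx1.
apply/matrixP => j l; rewrite circulantE mxE.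
under eq_bigr do rewrite mxE mul1r.
rewrite sum_cis //; case: eqVneq => [->|jl].
  rewrite subrr dvdz0 -(rmorph_nat rc) -rmorphM /= mulVf ?rmorph1 //.
  by rewrite pnatr_eq0 -lt0n.
case: ifPn; last by rewrite mulr0.
move=> nd; exfalso; move: nd jl.
rewrite dvdzE /= => /dvdn_leq; have := ltn_ord j; have := ltn_ord l.
rewrite -(inj_eq val_inj) /=; lia.
Qed.

End FourierMatrix.

(** * Real quadratic forms of Hermitian matrices *)

Section RealForm.
Context {R : realType}.
Local Notation C := (Cplx R).

Definition rdot n (x y : 'cV[C]_n) : R := complex.Re ((x^t* *m y) ord0 ord0).

Lemma rdotDl n (x y z : 'cV[C]_n) : rdot (x + y) z = rdot x z + rdot y z.
Proof. by rewrite /rdot linearD /= map_mxD mulmxDl mxE cReD. Qed.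

Lemma rdotDr n (x y z : 'cV[C]_n) : rdot x (y + z) = rdot x y + rdot x z.
Proof. by rewrite /rdot mulmxDr mxE cReD. Qed.

Lemma rdotZr n c (x y : 'cV[C]_n) : rdot x (rc c *: y) = c * rdot x y.
Proof. by rewrite /rdot -scalemxAr mxE cReM /= mul0r subr0. Qed.

Lemma rdotC n (x y : 'cV[C]_n) : rdot x y = rdot y x.
Proof.
rewrite /rdot -[RHS]cReJ; congr complex.Re.
rewrite !mxE rmorph_sum; apply: eq_bigr => i _.
by rewrite !mxE rmorphM /= conjCK mulrC.
Qed.

Lemma rdotNr n (x y : 'cV[C]_n) : rdot x (- y) = - rdot x y.
Proof.
have -> : - y = rc (-1) *: y by rewrite rmorphN1 scaleN1r.
by rewrite rdotZr mulN1r.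
Qed.

Lemma rdot_self n (x : 'cV[C]_n) : rdot x x = l2_norm x ^+ 2.
Proof. by rewrite /rdot l2_norm_sqr_dot. Qed.

Lemma rdot_hermitian n (A : 'M[C]_n) (x y : 'cV[C]_n) : A^t* = A ->
  rdot x (A *m y) = rdot y (A *m x).
Proof.
move=> AA; rewrite rdotC /rdot trmx_mul map_mxM -mulmxA AA.
by [].
Qed.

Lemma rdotNl n (x y : 'cV[C]_n) : rdot (- x) y = - rdot x y.
Proof. by rewrite rdotC rdotNr rdotC. Qed.

Lemma rdot_parallelogram n (x y : 'cV[C]_n) :
  rdot (x + y) (x + y) + rdot (x - y) (x - y) = 2 * (rdot x x + rdot y y).
Proof.
rewrite !(rdotDl, rdotDr, rdotNl, rdotNr).
by move: (rdot x x) (rdot x y) (rdot y x) (rdot y y) => a b c d; ring.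
Qed.

Lemma rdot_polarization n (A : 'M[C]_n) (x y : 'cV[C]_n) : A^t* = A ->
  rdot (x + y) (A *m (x + y)) - rdot (x - y) (A *m (x - y)) = 4 * rdot y (A *m x).
Proof.
move=> AA; rewrite !(mulmxDr, mulmxN, rdotDl, rdotDr, rdotNl, rdotNr).
rewrite (rdot_hermitian x y AA).
move: (rdot x (A *m x)) (rdot y (A *m x)) (rdot y (A *m y)) => a b c.
by ring.
Qed.

(** A Hermitian matrix whose form is bounded by c has norm at most c.  By
    polarization and the parallelogram identity, 4 Re <y, A x> is at most
    2 c (|x|^2 + |y|^2); at y = c^-1 A x this reads |A x|^2 <= c^2 |x|^2. *)
Lemma opbound_of_form n (A : 'M[C]_n) c : 0 < c -> A^t* = A ->
  (forall x : 'cV[C]_n, `|rdot x (A *m x)| <= c * l2_norm x ^+ 2) -> opbound A c.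
Proof.
move=> c0 AA Ac x; rewrite l2_norm_le ?mulr_ge0 ?l2_norm_ge0 ?(ltW c0) //.
pose y : 'cV[C]_n := rc c^-1 *: (A *m x).
have := rdot_polarization x y AA; have := rdot_parallelogram x y.
have := Ac (x - y); have := Ac (x + y); rewrite -!rdot_self !ler_norml.
move=> /andP[_ h2] /andP[h1 _] par pol.
have yA : rdot y (A *m x) = c^-1 * l2_norm (A *m x) ^+ 2.
  by rewrite rdotC /y rdotZr rdot_self.
have yy : rdot y y = c^-1 ^+ 2 * l2_norm (A *m x) ^+ 2.
  by rewrite rdot_self /y l2_normZ cabs_rc ger0_norm ?invr_ge0 ?ltW // exprMn.
have h3 : 4 * rdot y (A *m x) <= 2 * c * (rdot x x + rdot y y).
  by rewrite -pol -mulrA (mulrCA 2) -par mulrDr lerD // lerNl.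
move: h3; rewrite yA yy exprMn !rdot_self.
move: (l2_norm (A *m x) ^+ 2) (l2_norm x ^+ 2) => a b h3 {h1 h2 par pol yA yy}.
have -> : a = c * (c^-1 * a) by rewrite mulVKf // gt_eqF.
rewrite expr2 -mulrA ler_pM2l //.
move: h3; rewrite expr2.
have -> : 2 * c * (b + c^-1 * c^-1 * a) = 2 * (c * b) + 2 * (c^-1 * a).
  by field; rewrite gt_eqF.
by lra.
Qed.
End RealForm.

(** * The quadratic form of a Toeplitz matrix *)

Section ComplexIntegral.
Context {R : realType}.
Local Notation C := (Cplx R).
Local Notation mu := (@lebesgue_measure R).
Local Notation D := (`[- pi, pi]%classic : set R).
Implicit Types (F G : R -> C) (f g : R -> R).

(** Continuity is stated on the two real coordinates because the integral of a
    complex function is defined coordinatewise. *)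
Definition ccont F := continuous (fun x => complex.Re (F x)) /\
                      continuous (fun x => complex.Im (F x)).

Lemma continuous_integrable f : continuous f -> mu.-integrable D (EFin \o f).
Proof.
move=> cf; apply: continuous_compact_integrable; first exact: segment_compact.
exact: continuous_subspaceT.
Qed.

Lemma cintegralE F : cintegral D F =
  rc (\int[mu]_(x in D) complex.Re (F x)) + 'i%C * rc (\int[mu]_(x in D) complex.Im (F x)).
Proof. by rewrite {1}(complexE (cintegral D F)). Qed.

Lemma ccontD F G : ccont F -> ccont G -> ccont (fun x => F x + G x).
Proof.
move=> [F1 F2] [G1 G2]; split=> x.
  under eq_fun do rewrite cReD; exact: cvgD (F1 x) (G1 x).
under eq_fun do rewrite cImD; exact: cvgD (F2 x) (G2 x).
Qed.

Lemma ccontM F G : ccont F -> ccont G -> ccont (fun x => F x * G x).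
Proof.
move=> [F1 F2] [G1 G2]; split=> x.
  under eq_fun do rewrite cReM.
  exact: cvgB (cvgM (F1 x) (G1 x)) (cvgM (F2 x) (G2 x)).
under eq_fun do rewrite cImM.
exact: cvgD (cvgM (F1 x) (G2 x)) (cvgM (F2 x) (G1 x)).
Qed.

Lemma ccont_cst (z : C) : ccont (fun=> z).
Proof. by split=> x; exact: cvg_cst. Qed.

Lemma ccont_rc f : continuous f -> ccont (fun x => rc (f x)).
Proof. by split=> x; [exact: H | exact: cvg_cst]. Qed.

Lemma ccont_cis f : continuous f -> ccont (fun x => cis (f x)).
Proof.
move=> cf; split=> x.
  by apply: (@continuous_comp _ _ _ f cos); [exact: cf | exact: continuous_cos].
by apply: (@continuous_comp _ _ _ f sin); [exact: cf | exact: continuous_sin].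
Qed.

Lemma ccont_sum (I : Type) (r : seq I) (P : pred I) (F : I -> R -> C) :
  (forall i, P i -> ccont (F i)) -> ccont (fun x => \sum_(i <- r | P i) F i x).
Proof.
move=> cF; elim: r => [|i r IH].
  have -> : (fun x => \sum_(i <- [::] | P i) F i x) = fun=> 0.
    by apply/funext => x; rewrite big_nil.
  exact: ccont_cst.
have -> : (fun x => \sum_(j <- i :: r | P j) F j x) =
    if P i then fun x => F i x + \sum_(j <- r | P j) F j x
    else fun x => \sum_(j <- r | P j) F j x.
  by case: ifP => Pi; apply/funext => x; rewrite big_cons Pi.
by case: ifP => // Pi; apply: ccontD => //; exact: cF.
Qed.

Lemma cintegralD F G : ccont F -> ccont G ->
  cintegral D (fun x => F x + G x) = cintegral D F + cintegral D G.
Proof.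
move=> [F1 F2] [G1 G2]; rewrite !cintegralE.
under eq_Rintegral do rewrite cReD.
under [in X in 'i%C * X]eq_Rintegral do rewrite cImD.
rewrite !RintegralD ?rmorphD /=; try exact: continuous_integrable; try exact: measurable_itv.
by ring.
Qed.

Lemma cintegralZ (z : C) F : ccont F ->
  cintegral D (fun x => z * F x) = z * cintegral D F.
Proof.
move=> [F1 F2].
have mD : measurable D by exact: measurable_itv.
have iRe := continuous_integrable F1; have iIm := continuous_integrable F2.
have cZ (c : R) f : continuous f -> continuous (fun x => c * f x).
  by move=> cf x; apply: cvgM; [exact: cvg_cst | exact: cf].
have E1 : \int[mu]_(x in D) complex.Re (z * F x) =
   complex.Re z * \int[mu]_(x in D) complex.Re (F x) -
   complex.Im z * \int[mu]_(x in D) complex.Im (F x).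
  under eq_Rintegral do rewrite cReM.
  rewrite RintegralB ?RintegralZl //; apply: continuous_integrable; exact: cZ.
have E2 : \int[mu]_(x in D) complex.Im (z * F x) =
   complex.Re z * \int[mu]_(x in D) complex.Im (F x) +
   complex.Im z * \int[mu]_(x in D) complex.Re (F x).
  under eq_Rintegral do rewrite cImM.
  rewrite RintegralD ?RintegralZl //; apply: continuous_integrable; exact: cZ.
by rewrite /cintegral E1 E2; case: z {E1 E2}.
Qed.

Lemma cintegral_sum (I : Type) (r : seq I) (P : pred I) (F : I -> R -> C) :
  (forall i, P i -> ccont (F i)) ->
  cintegral D (fun x => \sum_(i <- r | P i) F i x) =
  \sum_(i <- r | P i) cintegral D (F i).
Proof.
move=> cF; elim: r => [|i r IH].
  rewrite big_nil /cintegral.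
  under eq_Rintegral do rewrite big_nil.
  under [X in _ +i* X]eq_Rintegral do rewrite big_nil.
  by rewrite !Rintegral_cst ?mul0r //; exact: measurable_itv.
rewrite big_cons; have [Pi|Pi] := boolP (P i); last first.
  by rewrite -IH; congr cintegral; apply/funext => x; rewrite big_cons (negPf Pi).
rewrite -IH -cintegralD; [|exact: cF|exact: ccont_sum].
by congr cintegral; apply/funext => x; rewrite big_cons Pi.
Qed.
End ComplexIntegral.

Section ToeplitzForm.
Context {R : realType}.
Local Notation C := (Cplx R).
Local Notation mu := (@lebesgue_measure R).
Local Notation D := (`[- pi, pi]%classic : set R).
Implicit Types (f g : R -> R) (k : int).

Let mode k (t : R) : C := cis (- (k%:~R * t)).

Lemma ccont_mode f k : continuous f -> ccont (fun t => rc (f t) * mode k t).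
Proof.
move=> cf; apply: ccontM; first exact: ccont_rc.
apply: ccont_cis => x; apply: cvgN; apply: cvgM; [exact: cvg_cst | exact: cvg_id].
Qed.

Lemma fourierE f k :
  fourier f k = rc (2 * pi)^-1 * cintegral D (fun t => rc (f t) * mode k t).
Proof. by []. Qed.

Lemma fourierB f g k : continuous f -> continuous g ->
  fourier (fun t => f t - g t) k = fourier f k - fourier g k.
Proof.
move=> cf cg; rewrite !fourierE -mulrBr; congr (_ * _).
rewrite -mulN1r -cintegralZ; last exact: ccont_mode.
rewrite -cintegralD; first last.
- by apply: ccontM; [exact: ccont_cst | exact: ccont_mode].
- exact: ccont_mode.
by congr cintegral; apply/funext => t; rewrite rmorphB /= mulrBl mulN1r.
Qed.

Lemma fourierN f k : continuous f -> fourier f (- k) = (fourier f k)^*.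
Proof.
move=> cf; rewrite !fourierE rmorphM /= conj_rc; congr (_ * _).
have modeN t : rc (f t) * mode (- k) t = (rc (f t) * mode k t)^*.
  by rewrite rmorphM /= conj_rc cisJ /mode intrN mulNr.
have [c1 c2] := ccont_mode k cf.
rewrite /cintegral -[RHS]/(Complex _ (- _)); congr Complex.
  by congr fine; apply: eq_integral => t _; rewrite modeN cReJ.
rewrite -mulN1r -RintegralZl //; last exact: continuous_integrable.
by congr fine; apply: eq_integral => t _; rewrite modeN cImJ mulN1r.
Qed.

(** The points pi and - pi differ by a period, so integrals of nonconstant
    characters over the interval vanish. *)
Lemma sin_cos_mode_pi k : cos (k%:~R * pi) = cos (k%:~R * - pi) :> R /\
  sin (k%:~R * pi) = sin (k%:~R * - pi) :> R.
Proof.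
have : cis (k%:~R * pi) = cis (k%:~R * - pi) :> C.
  rewrite -[RHS]mul1r -(cis_period k) -cisD; congr cis; ring.
by rewrite /cis => -[].
Qed.

Lemma Rintegral_derivative (f F : R -> R) : continuous f ->
  (forall x : R, is_derive x 1 F (f x)) ->
  \int[mu]_(x in D) f x = F pi - F (- pi).
Proof.
move=> cf dF; rewrite /Rintegral (@continuous_FTC2 _ f F) //.
- by rewrite gtrN ?pi_gt0.
- exact: continuous_subspaceT.
- have cF x : {for x, continuous F}.
    apply: differentiable_continuous; apply/derivable1_diffP.
    exact: (@ex_derive _ _ _ _ _ _ _ (dF x)).
  split; first by move=> x _; exact: (@ex_derive _ _ _ _ _ _ _ (dF x)).
  + exact/cvg_at_right_filter/cF.
  + exact/cvg_at_left_filter/cF.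
- by move=> x _; rewrite derive1E; exact: (@derive_val _ _ _ _ _ _ _ (dF x)).
Qed.

Lemma fourier_cst (c : R) k : fourier (fun=> c) k = if k == 0 then rc c else 0.
Proof.
have pi0 : pi != 0 :> R by rewrite gt_eqF ?pi_gt0.
have ccst : continuous (fun _ : R => 1 : R) by move=> x; exact: cvg_cst.
rewrite fourierE cintegralZ; last first.
  have [h1 h2] := ccont_mode k ccst; split=> x; have := h1 x; have := h2 x.
    by move=> _; under eq_fun do rewrite rmorph1 mul1r.
  by under eq_fun do rewrite rmorph1 mul1r.
case: eqVneq => [->|k0].
  have -> : mode 0 = fun=> 1.
    by apply/funext => t; rewrite /mode mul0r oppr0 cis0.
  rewrite /cintegral /= !Rintegral_cst //= !lebesgue_measure_itv /= lte_fin gtrN ?pi_gt0 //=.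
  rewrite mul0r mul1r -[_ +i* 0]/(rc _) -!rmorphM /=.
  by congr rc; rewrite opprK; move: pi pi0 => p p0; field.
have kR : k%:~R != 0 :> R by rewrite intr_eq0.
have [cosE sinE] := sin_cos_mode_pi k.
have id1 (x : R) : is_derive x 1 (fun t => k%:~R * t : R) (k%:~R).
  have := @is_deriveZ _ _ _ (@id R) (k%:~R) x 1 1 (is_derive_id x 1).
  by rewrite /GRing.scale /= mulr1.
have kc : continuous (fun t : R => - (k%:~R * t) : R).
  by move=> x; apply: cvgN; apply: cvgM; [exact: cvg_cst | exact: cvg_id].
have -> : cintegral D (mode k) = 0.
  rewrite /cintegral /mode; congr Complex.
    have cg : continuous (fun t : R => cos (- (k%:~R * t)) : R) := (ccont_cis kc).1.
    have dg (x : R) : is_derive x 1 (fun t => k%:~R^-1 * sin (k%:~R * t) : R)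
        (cos (- (k%:~R * x))).
      rewrite cosN.
      have := @is_deriveZ _ _ _ (fun t : R => sin (k%:~R * t)) (k%:~R^-1) x 1 _
        (is_derive1_comp (is_derive_sin _) (id1 x)).
      by rewrite /GRing.scale /= mulrCA mulVf // mulr1.
    by rewrite (Rintegral_derivative cg dg) sinE subrr.
  have cg : continuous (fun t : R => sin (- (k%:~R * t)) : R) := (ccont_cis kc).2.
  have dg (x : R) : is_derive x 1 (fun t => k%:~R^-1 * cos (k%:~R * t) : R)
      (sin (- (k%:~R * x))).
    rewrite sinN.
    have := @is_deriveZ _ _ _ (fun t : R => cos (k%:~R * t)) (k%:~R^-1) x 1 _
      (is_derive1_comp (is_derive_cos _) (id1 x)).
    by rewrite /GRing.scale /= mulrCA mulVf // mulr1.
  by rewrite (Rintegral_derivative cg dg) cosE subrr.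
by rewrite !mulr0.
Qed.

Lemma toeplitz_hermitian f n : continuous f -> (toeplitz f n)^t* = toeplitz f n.
Proof. by move=> cf; apply/matrixP => i j; rewrite !mxE -fourierN // opprB. Qed.

(** Expanding |p|^2 for p(t) = sum_l x_l exp(i l t) produces the modes
    exp(- i (j - l) t), whose integrals against f are the entries of the
    Toeplitz matrix. *)
Lemma toeplitz_form f n (x : 'cV[C]_n) : continuous f ->
  (x^t* *m (toeplitz f n *m x)) ord0 ord0 = rc (2 * pi)^-1 *
  cintegral D (fun t => rc (f t * cabs (\sum_l x l ord0 * mode (- l%:Z) t) ^+ 2)).
Proof.
move=> cf.
have -> : (fun t => rc (f t * cabs (\sum_l x l ord0 * mode (- l%:Z) t) ^+ 2)) =
  (fun t => \sum_j \sum_l ((x j ord0)^* * x l ord0) * (rc (f t) * mode (j%:Z - l%:Z) t)).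
  apply/funext => t; rewrite rmorphM /= -cabs_sqr mulrC rmorph_sum /= big_distrlr /=.
  rewrite exchange_big /= mulr_suml; apply: eq_bigr => j _; rewrite mulr_suml.
  apply: eq_bigr => l _.
  have -> : mode (j%:Z - l%:Z) t = mode (- l%:Z) t * (mode (- j%:Z) t)^*.
    by rewrite /mode cisJ -cisD; congr cis; rewrite intrB !intrN; ring.
  by rewrite rmorphM /=; ring.
have cS j l : ccont (fun t => (x j ord0)^* * x l ord0 * (rc (f t) * mode (j%:Z - l%:Z) t)).
  by apply: ccontM; [exact: ccont_cst | exact: ccont_mode].
rewrite cintegral_sum; last by move=> j _; apply: ccont_sum.
rewrite mxE mulr_sumr; apply: eq_bigr => j _.
rewrite cintegral_sum // !mxE mulr_sumr mulr_sumr; apply: eq_bigr => l _.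
rewrite cintegralZ; last exact: ccont_mode.
by rewrite mxE fourierE; ring.
Qed.

Lemma toeplitz_form_ge0 f n (x : 'cV[C]_n) : continuous f -> (forall t, 0 <= f t) ->
  0 <= rdot x (toeplitz f n *m x).
Proof.
move=> cf f0; rewrite /rdot toeplitz_form // cReM /= mul0r subr0.
rewrite mulr_ge0 ?invr_ge0 ?mulr_ge0 ?pi_ge0 //.
by apply: Rintegral_ge0 => t _; rewrite mulr_ge0 ?sqr_ge0.
Qed.

Lemma toeplitz_cst (c : R) n : toeplitz (fun=> c) n = (rc c)%:M.
Proof.
apply/matrixP => i j; rewrite !mxE fourier_cst subr_eq0 eqz_nat.
by rewrite (inj_eq val_inj); case: eqP => // ->; rewrite eqxx.
Qed.

Lemma toeplitzB f g n : continuous f -> continuous g ->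
  toeplitz (fun t => f t - g t) n = toeplitz f n - toeplitz g n.
Proof. by move=> cf cg; apply/matrixP => i j; rewrite !mxE fourierB. Qed.

Lemma rdot_scalar n (c : R) (x : 'cV[C]_n) : rdot x ((rc c)%:M *m x) = c * l2_norm x ^+ 2.
Proof. by rewrite mul_scalar_mx rdotZr rdot_self. Qed.

(** Positivity of the form for f - m, the Toeplitz matrix of a constant being
    scalar. *)
Lemma toeplitz_form_ge f n (m : R) (x : 'cV[C]_n) : continuous f -> (forall t, m <= f t) ->
  m * l2_norm x ^+ 2 <= rdot x (toeplitz f n *m x).
Proof.
move=> cf mf; have cm : continuous (fun _ : R => m) by move=> t; exact: cvg_cst.
have := @toeplitz_form_ge0 (fun t => f t - m) n x.
rewrite toeplitzB // toeplitz_cst mulmxBl rdotDr rdotNr rdot_scalar subr_ge0; apply.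
  by move=> t; apply: cvgB; [exact: cf | exact: cm].
by move=> t; rewrite subr_ge0.
Qed.

Lemma toeplitz_form_le f n (M : R) (x : 'cV[C]_n) : continuous f -> (forall t, f t <= M) ->
  rdot x (toeplitz f n *m x) <= M * l2_norm x ^+ 2.
Proof.
move=> cf fM; have cM : continuous (fun _ : R => M) by move=> t; exact: cvg_cst.
have := @toeplitz_form_ge0 (fun t => M - f t) n x.
rewrite toeplitzB // toeplitz_cst mulmxBl rdotDr rdotNr rdot_scalar subr_ge0; apply.
  by move=> t; apply: cvgB; [exact: cM | exact: cf].
by move=> t; rewrite subr_ge0.
Qed.

Lemma opbound_toeplitz f n (m M : R) : continuous f -> 0 < m ->
  (forall t, m <= f t) -> (forall t, f t <= M) -> opbound (toeplitz f n) M.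
Proof.
move=> cf m0 mf fM; have M0 : 0 < M := lt_le_trans m0 (le_trans (mf 0) (fM 0)).
apply: opbound_of_form => //; first exact: toeplitz_hermitian.
move=> x; rewrite ger0_norm ?toeplitz_form_le //.
by apply: toeplitz_form_ge0 => // t; apply: le_trans (mf t); exact: ltW.
Qed.
End ToeplitzForm.

(** * Matrices diagonalized by a unitary matrix *)

(** With U the Fourier matrix, [udiag] describes the circulants, and [fconj] is
    the passage to the Fourier basis.  Both are locked so that rewriting never
    unfolds them to matrix products. *)
HB.lock Definition udiag (R : realType) (n : nat) (U : 'M[Cplx R]_n)
  (w : 'rV[Cplx R]_n) : 'M[Cplx R]_n := U^t* *m diag_mx w *m U.
HB.lock Definition fconj (R : realType) (n : nat) (U A : 'M[Cplx R]_n) :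
  'M[Cplx R]_n := U *m A *m U^t*.

Section UnitaryDiagonal.
Context {R : realType} {n : nat}.
Local Notation C := (Cplx R).
Variable U : 'M[C]_n.
Hypothesis UJU : U^t* *m U = 1%:M.
Implicit Types (A B : 'M[C]_n) (v w : 'rV[C]_n).

Let UUJ : U *m U^t* = 1%:M. Proof. exact: mulmx1C. Qed.

Local Notation udiagU := (udiag U).
Local Notation fconjU := (fconj U).

Lemma fconjM A B : fconjU (A *m B) = fconjU A *m fconjU B.
Proof.
rewrite !fconj.unlock -!mulmxA; congr (_ *m (_ *m _)).
by rewrite !mulmxA UJU mul1mx.
Qed.

Lemma fconjB A B : fconjU (A - B) = fconjU A - fconjU B.
Proof. by rewrite !fconj.unlock mulmxBr mulmxBl. Qed.

Lemma fconjD A B : fconjU (A + B) = fconjU A + fconjU B.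
Proof. by rewrite !fconj.unlock mulmxDr mulmxDl. Qed.

Lemma fconj1 : fconjU 1%:M = 1%:M.
Proof. by rewrite !fconj.unlock mulmx1 UUJ. Qed.

Lemma fconjJ A : (fconjU A)^t* = fconjU (A^t*).
Proof. by rewrite !fconj.unlock !trmx_mul !map_mxM trmxCK mulmxA. Qed.

Lemma fconjK A : U^t* *m fconjU A *m U = A.
Proof. by rewrite !fconj.unlock !mulmxA UJU mul1mx -mulmxA UJU mulmx1. Qed.

Lemma fconj_udiag w : fconjU (udiagU w) = diag_mx w.
Proof. by rewrite !fconj.unlock udiag.unlock !mulmxA UUJ mul1mx -mulmxA UUJ mulmx1. Qed.

Lemma l2_normUJ (x : 'cV[C]_n) : l2_norm (U^t* *m x) = l2_norm x.
Proof. by apply: l2_norm_unitary; rewrite trmxCK. Qed.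

Lemma opbound_fconj A c : opbound A c -> opbound (fconjU A) c.
Proof. by move=> Ac x; rewrite fconj.unlock -!mulmxA l2_norm_unitary // -(l2_normUJ x). Qed.

Lemma opbound_udiag w c : 0 <= c -> (forall i, cabs (w ord0 i) <= c) -> opbound (udiagU w) c.
Proof.
move=> c0 wc x; rewrite udiag.unlock -!mulmxA l2_normUJ -(l2_norm_unitary UJU x).
exact: opbound_diag.
Qed.

Lemma mxrank_udiag w (J : {set 'I_n}) : (forall i, i \notin J -> w ord0 i = 0) ->
  (\rank (udiagU w) <= #|J|)%N.
Proof.
move=> w0; rewrite udiag.unlock.
apply: leq_trans (mxrankM_maxl _ _) _; apply: leq_trans (mxrankM_maxr _ _) _.
apply: mxrank_row_support => i j iJ; rewrite mxE.
by case: eqP => [_|//]; rewrite w0.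
Qed.

Lemma fconjE A : fconjU A = U *m A *m U^t*. Proof. by rewrite fconj.unlock. Qed.

Lemma fconj_inj : injective fconjU.
Proof. by move=> A B AB; rewrite -[A]fconjK AB fconjK. Qed.

Lemma udiagM v w : udiagU v *m udiagU w = udiagU (\row_j (v ord0 j * w ord0 j)).
Proof.
have : diag_mx v *m diag_mx w = diag_mx (\row_j (v ord0 j * w ord0 j)).
  by rewrite mulmx_diag.
move: (\row_j _) => u vw; apply: fconj_inj.
by rewrite fconjM !fconj_udiag.
Qed.

Lemma udiagD v w : udiagU (v + w) = udiagU v + udiagU w.
Proof.
have : diag_mx v + diag_mx w = diag_mx (v + w) by rewrite linearD.
by move: (v + w) => u vw; apply: fconj_inj; rewrite fconjD !fconj_udiag.
Qed.

Lemma udiag1 : udiagU (const_mx 1) = 1%:M.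
Proof. by apply: fconj_inj; rewrite fconj_udiag fconj1 diag_const_mx. Qed.

Lemma udiagJ w : (udiagU w)^t* = udiagU (\row_j (w ord0 j)^*).
Proof.
have : (diag_mx w)^t* = diag_mx (\row_j (w ord0 j)^*).
  by apply/matrixP => i j; rewrite !mxE rmorphMn /= eq_sym; case: eqP => // ->.
by move: (\row_j _) => u wu; apply: fconj_inj; rewrite -fconjJ !fconj_udiag.
Qed.

Lemma udiag_inv w : (forall i, w ord0 i != 0) ->
  udiagU w \in unitmx /\ invmx (udiagU w) = udiagU (\row_j (w ord0 j)^-1).
Proof.
move=> w0; have w1 : udiagU w *m udiagU (\row_j (w ord0 j)^-1) = 1%:M.
  rewrite udiagM -udiag1; congr udiag; apply/rowP => j.
  by rewrite !mxE divff.
have [wu _] := mulmx1_unit w1; split=> //.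
by rewrite -[LHS]mulmx1 -w1 mulmxA mulVmx // mul1mx.
Qed.

Lemma udiag_unit_neq0 w i : udiagU w \in unitmx -> w ord0 i != 0.
Proof.
move=> wu; have : diag_mx w \in unitmx.
  have [Uu UJu] := mulmx1_unit UUJ.
  by rewrite -(fconj_udiag w) fconjE unitmx_mul UJu andbT unitmx_mul Uu.
by rewrite unitmxE det_diag unitfE => /prodf_neq0; apply.
Qed.

Lemma frobenius_sqr m p (A : 'M[C]_(m, p)) :
  frobenius_norm A ^+ 2 = \sum_i \sum_j cabs (A i j) ^+ 2.
Proof.
rewrite sqr_sqrtr // sumr_ge0 // => i _.
by rewrite sumr_ge0 // => j _; rewrite sqr_ge0.
Qed.

Lemma frobenius_ge0 m p (A : 'M[C]_(m, p)) : 0 <= frobenius_norm A.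
Proof. exact: sqrtr_ge0. Qed.

Lemma frobenius_cols m p (A : 'M[C]_(m, p)) :
  frobenius_norm A ^+ 2 = \sum_j l2_norm (col j A) ^+ 2.
Proof.
rewrite frobenius_sqr exchange_big; apply: eq_bigr => j _.
by rewrite l2_norm_sqr; apply: eq_bigr => i _; rewrite mxE.
Qed.

Lemma frobenius_adj m p (A : 'M[C]_(m, p)) : frobenius_norm (A^t*) ^+ 2 = frobenius_norm A ^+ 2.
Proof.
rewrite !frobenius_sqr exchange_big; apply: eq_bigr => i _; apply: eq_bigr => j _.
by rewrite !mxE cabsJ.
Qed.

Lemma frobenius_unitaryl p (A : 'M[C]_(n, p)) :
  frobenius_norm (U *m A) ^+ 2 = frobenius_norm A ^+ 2.
Proof.
rewrite !frobenius_cols; apply: eq_bigr => j _.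
by rewrite !colE -mulmxA l2_norm_unitary.
Qed.

Lemma frobenius_fconj A : frobenius_norm (fconjU A) ^+ 2 = frobenius_norm A ^+ 2.
Proof.
rewrite fconjE -frobenius_adj trmx_mul map_mxM trmxCK frobenius_unitaryl.
by rewrite -frobenius_adj trmxCK frobenius_unitaryl.
Qed.

End UnitaryDiagonal.

(** * The superoptimal preconditioner *)

Section Superoptimal.
Context {R : realType}.
Local Notation C := (Cplx R).

Definition rowsq n (B : 'M[C]_n) i : R := \sum_j cabs (B i j) ^+ 2.
Definition rdiag n (B : 'M[C]_n) i : R := complex.Re (B i i).

Lemma rowsq_gt0 n (B : 'M[C]_n) i : B i i = rc (rdiag B i) -> 0 < rdiag B i ->
  0 < rowsq B i.
Proof.
move=> Bii b0; rewrite /rowsq (bigD1 i) //= ltr_wpDr ?sumr_ge0 //.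
  by move=> j _; rewrite sqr_ge0.
by rewrite Bii cabs_rc exprn_gt0 // gtr0_norm.
Qed.

(** Completing the square in z: the cost of the i-th row of I - diag(z) B is
    1 - 2 Re z B_ii + |z|^2 sum_j |B_ij|^2. *)
Lemma row_cost n (B : 'M[C]_n) (z : C) i : B i i = rc (rdiag B i) -> 0 < rdiag B i ->
  \sum_j cabs ((i == j)%:R - z * B i j) ^+ 2 =
  rowsq B i * cabs (z - rc (rdiag B i / rowsq B i)) ^+ 2 + (1 - rdiag B i ^+ 2 / rowsq B i).
Proof.
move=> Bii b0; have S0 := rowsq_gt0 Bii b0.
have -> : \sum_j cabs ((i == j)%:R - z * B i j) ^+ 2 =
    1 - 2 * (complex.Re z * rdiag B i) + cabs z ^+ 2 * rowsq B i.
  rewrite /rowsq (bigD1 i) //= (bigD1 (F := fun j => cabs (B i j) ^+ 2) i) //= mulrDr addrA.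
  congr (_ + _); last first.
    rewrite mulr_sumr; apply: eq_bigr => j ji.
    by rewrite eq_sym (negPf ji) sub0r cabsN cabsM exprMn.
  rewrite eqxx -exprMn -cabsM !cabs_ReIm Bii.
  move: (rdiag B i) => b; case: z => x y.
  rewrite -[(x +i* y) * rc b]/((x * b - y * 0) +i* (x * 0 + y * b)) /=.
  by ring.
rewrite !cabs_ReIm; move: (rdiag B i) (rowsq B i) S0 => b S S0.
case: z => x y /=.
by field; rewrite gt_eqF.
Qed.

(** By unitary invariance the functional is the sum over i of the row costs at
    z = 1 / w_i.  Comparison with the single competitor that minimizes every row
    cost at once, whose entries are nonzero, forces each row to be optimal. *)
Lemma superoptimal_udiag n (U A : 'M[C]_n) (w : 'rV[C]_n) : U^t* *m U = 1%:M ->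
  (forall i, fconj U A i i = rc (rdiag (fconj U A) i)) ->
  (forall i, 0 < rdiag (fconj U A) i) ->
  udiag U w \in unitmx ->
  (forall v, udiag U v \in unitmx ->
     frobenius_norm (1%:M - invmx (udiag U w) *m A) <=
     frobenius_norm (1%:M - invmx (udiag U v) *m A)) ->
  w = \row_i rc (rowsq (fconj U A) i / rdiag (fconj U A) i).
Proof.
move=> UJU; set B := fconj U A => Bii b0 wu wmin.
pose d i := rdiag B i / rowsq B i.
have S0 i : 0 < rowsq B i by apply: rowsq_gt0.
have d0 i : 0 < d i by rewrite divr_gt0 ?b0.
have w0 i : w ord0 i != 0 by exact: udiag_unit_neq0 wu.
pose v : 'rV[C]_n := \row_i rc (rowsq B i / rdiag B i).
have vE i : (v ord0 i)^-1 = rc (d i) by rewrite mxE -fmorphV /= invf_div.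
have v0 i : v ord0 i != 0.
  by rewrite -invr_eq0 vE -(rmorph0 rc) (inj_eq rc_inj) gt_eqF.
have cost (u : 'rV[C]_n) : (forall i, u ord0 i != 0) ->
    frobenius_norm (1%:M - invmx (udiag U u) *m A) ^+ 2 =
    \sum_i (rowsq B i * cabs ((u ord0 i)^-1 - rc (d i)) ^+ 2 +
            (1 - rdiag B i ^+ 2 / rowsq B i)).
  move=> u0; have [_ ->] := udiag_inv UJU u0.
  rewrite -(frobenius_fconj UJU) fconjB fconj1 // fconjM // fconj_udiag // -/B.
  rewrite frobenius_sqr; apply: eq_bigr => i _; rewrite -row_cost ?b0 //.
  by apply: eq_bigr => j _; rewrite mul_diag_mx !mxE.
have [vu _] := udiag_inv UJU v0.
(* The minimality of w against v, squared, compares the two sums of row costs. *)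
have le2 := lerXn2r 2 (frobenius_ge0 _) (frobenius_ge0 _) (wmin _ vu).
have le1 := eq_ind _ (fun z => z <= _) le2 _ (cost w w0).
have := eq_ind _ (fun z => _ <= z) le1 _ (cost v v0).
rewrite !big_split /= lerD2r.
have -> : \sum_i rowsq B i * cabs ((v ord0 i)^-1 - rc (d i)) ^+ 2 = 0.
  by apply: big1 => i _; rewrite vE subrr cabs0 expr0n mulr0.
move=> le0; apply/rowP => i; rewrite [RHS]mxE.
have ge0 k : 0 <= rowsq B k * cabs ((w ord0 k)^-1 - rc (d k)) ^+ 2.
  by rewrite mulr_ge0 ?sqr_ge0 // ltW.
have : rowsq B i * cabs ((w ord0 i)^-1 - rc (d i)) ^+ 2 = 0.
  apply/eqP; rewrite eq_le ge0 andbT; apply: le_trans le0.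
  by rewrite (bigD1 i) //= lerDl sumr_ge0.
move/eqP; rewrite mulf_eq0 gt_eqF //= sqrf_eq0 cabs_eq0 subr_eq0 => /eqP wd.
by rewrite -[LHS]invrK wd -fmorphV /= invf_div.
Qed.
End Superoptimal.

(** * The symbol of the preconditioner is close to that of the matrix *)

Section DiagonalPlusLowRank.
Context {R : realType}.
Local Notation C := (Cplx R).
Variables (n : nat) (U A : 'M[C]_n) (m : R).
Hypothesis UJU : U^t* *m U = 1%:M.
Hypothesis AJ : A^t* = A.
Hypothesis m0 : 0 < m.
Hypothesis Am : forall x : 'cV[C]_n, m * l2_norm x ^+ 2 <= rdot x (A *m x).

Local Notation B := (fconj U A).

Let BJ i j : B j i = (B i j)^*.
Proof.
have : B^t* = B by rewrite fconjJ AJ.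
by move=> /matrixP /(_ j i); rewrite !mxE.
Qed.

Lemma fconj_diag_real i : B i i = rc (rdiag B i).
Proof.
have /CrealP/RRe_real <- : (B i i)^* = B i i by rewrite -BJ.
by [].
Qed.

Lemma fconj_diag_ge i : m <= rdiag B i.
Proof.
pose x : 'cV[C]_n := U^t* *m delta_mx i ord0.
have -> : rdiag B i = rdot x (A *m x).
  rewrite /rdiag /rdot /x trmx_mul map_mxM trmxCK -mulmxA.
  have -> : U *m (A *m (U^t* *m delta_mx i ord0)) = col i B.
    by rewrite colE fconjE !mulmxA.
  congr complex.Re; rewrite mxE (bigD1 i) //= big1 ?addr0.
    by rewrite !mxE !eqxx rmorph1 mul1r.
  by move=> j ji; rewrite !mxE (negPf ji) rmorph0 mul0r.
have := Am x; rewrite l2_normUJ // l2_norm_delta expr1n mulr1.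
by [].
Qed.

Lemma rowsq_col i : rowsq B i = l2_norm (col i B) ^+ 2.
Proof.
by rewrite l2_norm_sqr; apply: eq_bigr => j _; rewrite mxE BJ cabsJ.
Qed.

(** The numerator is the squared norm of a column of B, the denominator a value
    of the form of A at a unit vector. *)
Lemma superoptimal_symbol_le M i : 0 <= M -> opbound A M ->
  rowsq B i / rdiag B i <= M ^+ 2 / m.
Proof.
move=> M0 AM; have b0 : 0 < rdiag B i := lt_le_trans m0 (fconj_diag_ge i).
apply: ler_pM; rewrite ?invr_ge0 ?(ltW b0) ?lef_pV2 ?posrE ?fconj_diag_ge //.
  by apply: sumr_ge0 => j _; rewrite sqr_ge0.
rewrite rowsq_col -l2_norm_le // colE.
have := opbound_fconj UJU AM (delta_mx i ord0).
by rewrite l2_norm_delta mulr1.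
Qed.

Variables (s : 'rV[C]_n) (Rc E : 'M[C]_n) (d : R).
Hypothesis A_split : A = udiag U s + Rc + E.
Hypothesis d0 : 0 < d.
Hypothesis Ed : opbound E d.

Let v i : R := l2_norm (col i (fconj U Rc)) + d.

(** The i-th column of B - diag(s) has norm at most v_i.  Its diagonal entry
    controls B_ii - s_i, its off-diagonal part controls lambda_i - B_ii, which
    is the sum of the |B_ji|^2 with j <> i divided by B_ii. *)
Lemma superoptimal_symbol_close i :
  cabs (s ord0 i - rc (rowsq B i / rdiag B i)) <= v i + v i ^+ 2 / m.
Proof.
have b0 : 0 < rdiag B i := lt_le_trans m0 (fconj_diag_ge i).
have BE : B = diag_mx s + (fconj U Rc + fconj U E).
  by rewrite A_split -addrA !fconjD fconj_udiag.
have vge : l2_norm (col i (B - diag_mx s)) <= v i.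
  rewrite BE addrC addKr linearD /=; apply: le_trans (l2_normD _ _) _.
  rewrite lerD2l colE.
  have := opbound_fconj UJU Ed (delta_mx i ord0).
  by rewrite l2_norm_delta mulr1.
have v0 : 0 <= v i by rewrite addr_ge0 ?l2_norm_ge0 ?(ltW d0).
have sB : cabs (s ord0 i - B i i) <= v i.
  apply: le_trans vge; apply: le_trans (cabs_le_l2_norm _ i).
  by rewrite !mxE eqxx mulr1n -cabsN opprB.
have off : rowsq B i - rdiag B i ^+ 2 <= v i ^+ 2.
  have le1 : l2_norm (col i (B - diag_mx s)) ^+ 2 <= v i ^+ 2.
    by apply: lerXn2r; rewrite // nnegrE ?l2_norm_ge0.
  apply: le_trans le1; rewrite l2_norm_sqr /rowsq (bigD1 i) //= [leRHS](bigD1 i) //=.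
  rewrite addrAC fconj_diag_real cabs_rc real_normK ?num_real // subrr add0r.
  rewrite -[leLHS]add0r lerD ?sqr_ge0 //.
  by apply: ler_sum => j ji; rewrite !mxE (negPf ji) mulr0n subr0 (BJ i j) cabsJ.
have -> : s ord0 i - rc (rowsq B i / rdiag B i) =
   (s ord0 i - B i i) + rc (- ((rowsq B i - rdiag B i ^+ 2) / rdiag B i)).
  have -> : rowsq B i / rdiag B i =
      rdiag B i + (rowsq B i - rdiag B i ^+ 2) / rdiag B i.
    by move: (rowsq B i) (rdiag B i) b0 => S b b0; field; rewrite gt_eqF.
  by rewrite fconj_diag_real rmorphN rmorphD /= opprD addrA.
apply: le_trans (cabsD _ _) _; rewrite lerD // cabs_rc normrN.
have diff0 : 0 <= rowsq B i - rdiag B i ^+ 2.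
  rewrite subr_ge0 /rowsq (bigD1 i) //= fconj_diag_real cabs_rc real_normK ?num_real //.
  by rewrite lerDl sumr_ge0 // => j _; rewrite sqr_ge0.
rewrite ger0_norm; last by rewrite divr_ge0 // ltW.
by apply: ler_pM; rewrite ?invr_ge0 ?(ltW b0) ?lef_pV2 ?posrE ?fconj_diag_ge.
Qed.

(** Each index where the column of the corner part exceeds d costs d^2 in the
    squared Frobenius norm, so there are at most q of them; on those the
    difference of the symbols is put into the low rank part. *)
Lemma superoptimal_lowrank_near k q :
  (\rank Rc <= k)%N -> frobenius_norm Rc ^+ 2 <= q%:R * d ^+ 2 ->
  lowrank_near (A - udiag U (\row_i rc (rowsq B i / rdiag B i)))
    (k + q) (d + (2 * d + (2 * d) ^+ 2 / m)).
Proof.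
move=> rk fr; set L := \row_i _.
pose J := [set i | d < l2_norm (col i (fconj U Rc))]%SET.
have Jq : (#|J| <= q)%N.
  have : #|J|%:R * d ^+ 2 <= q%:R * d ^+ 2.
    apply: le_trans fr; rewrite -(frobenius_fconj UJU) frobenius_cols.
    rewrite (bigID (mem J)) /= -[leLHS]addr0 lerD //; last first.
      by apply: sumr_ge0 => i _; rewrite sqr_ge0.
    rewrite mulr_natl -sumr_const; apply: ler_sum => i; rewrite inE => di.
    by apply: lerXn2r; rewrite ?nnegrE ?l2_norm_ge0 // ltW.
  by rewrite ler_pM2r ?exprn_gt0 // ler_nat.
(* The difference s - lambda on the exceptional indices, then off them. *)
pose g1 : 'rV[C]_n := \row_i (if i \in J then s ord0 i - L ord0 i else 0).
pose g2 : 'rV[C]_n := \row_i (if i \in J then 0 else s ord0 i - L ord0 i).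
have AL : A - udiag U L = (Rc + udiag U g1) + (E + udiag U g2).
  have sL : udiag U s = udiag U g1 + udiag U g2 + udiag U L.
    rewrite -!udiagD //; congr udiag; apply/rowP => i; rewrite !mxE.
    by case: ifP => _; rewrite ?add0r ?addr0 subrK.
  rewrite {1}A_split sL; move: (udiag U g1) (udiag U g2) (udiag U L) => u1 u2 u3.
  by rewrite -(addrA _ Rc E) addrAC addrK addrC addrACA.
exists (Rc + udiag U g1), (E + udiag U g2); split=> //.
  apply: leq_trans (mxrank_add _ _) _; rewrite leq_add //.
  apply: leq_trans Jq; apply: mxrank_udiag => i iJ.
  by rewrite mxE (negPf iJ).
apply: opboundD => //; apply: opbound_udiag => //.
  by rewrite addr_ge0 ?divr_ge0 ?sqr_ge0 ?mulr_ge0 // ltW.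
move=> i; rewrite mxE; case: ifPn => [_|].
  rewrite cabs0 addr_ge0 ?divr_ge0 ?sqr_ge0 ?mulr_ge0 //; exact: ltW.
rewrite inE -leNgt => di; rewrite mxE.
have v2 : v i <= 2 * d by rewrite /v mulr_natl mulr2n lerD2r.
have v0 : 0 <= v i by rewrite addr_ge0 ?l2_norm_ge0 ?(ltW d0).
apply: le_trans (superoptimal_symbol_close i) _.
rewrite lerD // ler_pM2r ?invr_gt0 //.
by apply: lerXn2r; rewrite // nnegrE // mulr_ge0 // ltW.
Qed.
End DiagonalPlusLowRank.

(** * Toeplitz matrices are circulant up to low rank and small norm *)

Section SummableTail.
Context {R : realType}.

(** Summation along an arbitrary injection phi, so that the same L serves for
    the rows and the columns of Toeplitz matrices of every size. *)
Lemma esum_tail (F : int -> R) (d : R) : (forall k, 0 <= F k) ->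
  (\esum_(k in [set: int]) (F k)%:E < +oo)%E -> 0 < d ->
  exists L : nat, forall (I : finType) (P : pred I) (phi : I -> int), injective phi ->
    (forall i, P i -> (L < `|phi i|)%N) -> \sum_(i | P i) F (phi i) <= d.
Proof.
move=> F0 Foo d0; pose S := (\esum_(k in [set: int]) (F k)%:E)%E.
have S0 : (0 <= S)%E by apply: esum_ge0 => k _; rewrite lee_fin.
have Sfin : S \is a fin_num by rewrite ge0_fin_numE.
have [_ [X [finX _] <-] SX] := ub_ereal_sup_adherent d0 Sfin.
have /finite_seqP[rx XE] := finX.
pose L := (\max_(x <- rx) `|x|)%N.
exists L => I P phi phi_inj Pphi.
pose r := [seq phi i | i <- enum P].
have ur : uniq r by rewrite map_inj_uniq ?enum_uniq.
have -> : \sum_(i | P i) F (phi i) = \sum_(k <- r) F k.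
  by rewrite big_map big_enum.
have Xr : X `&` [set` r] `<=` set0.
  move=> x [Xx /= xr].
  have [i iP xE] := @mapP _ _ phi (enum P) x xr.
  have Pi : P i by move: iP; rewrite mem_enum.
  have := Pphi i Pi; rewrite ltnNge => /negP; apply.
  by rewrite -xE; apply: (leq_bigmax_seq (F := fun x : int => `|x|%N)) => //; move: Xx; rewrite XE.
have : (\sum_(k \in X `|` [set` r]) (F k)%:E <= S)%E.
  apply: ereal_sup_ubound; exists (X `|` [set` r]) => //.
  split=> //; rewrite finite_setU; split=> //; exact: finite_seq.
have rsum : (\sum_(k \in [set` r]) (F k)%:E)%E = (\sum_(k <- r) F k)%:E.
  by rewrite -sumEFin [RHS]fsbig_seq.
have -> : (\sum_(k \in X `|` [set` r]) (F k)%:E)%E =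
    (\sum_(k \in X) (F k)%:E + (\sum_(k <- r) F k)%:E)%E.
  by rewrite -rsum; apply: fsbigU0 => //; exact: finite_seq.
move=> leS.
rewrite -lee_fin; have Xf : (\sum_(k \in X) (F k)%:E)%E \is a fin_num.
  by rewrite fsumEFin.
have := lt_le_trans SX (lexx _); rewrite lteBlDr // => /ltW SX'.
have := le_trans leS SX'; rewrite leeD2lE //.
Qed.
End SummableTail.

Section ToeplitzSplitting.
Context {R : realType}.
Local Notation C := (Cplx R).

Lemma card_corner n L : (L <= n)%N ->
  (#|[set i : 'I_n | (i < L)%N || (n <= i + L)%N]%SET| <= 2 * L)%N.
Proof.
move=> Ln; pose lo (k : 'I_L) : 'I_n := widen_ord Ln k.
pose hi (k : 'I_L) : 'I_n := rev_ord (widen_ord Ln k).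
have sub : [set i : 'I_n | (i < L)%N || (n <= i + L)%N]%SET \subset (lo @: 'I_L) :|: (hi @: 'I_L).
  apply/fintype.subsetP => i; rewrite !finset.inE => /orP[iL|iL].
    by apply/orP; left; apply/imsetP; exists (Ordinal iL) => //; apply: val_inj.
  apply/orP; right; apply/imsetP.
  have ri : (n - i.+1 < L)%N by have := ltn_ord i; lia.
  exists (Ordinal ri) => //; apply: val_inj => /=; have := ltn_ord i; lia.
apply: leq_trans (subset_leq_card sub) _.
apply: leq_trans (finset.leq_card_setU _ _) _; rewrite mul2n -addnn.
by rewrite leq_add // (leq_trans (leq_imset_card _ _)) ?card_ord.
Qed.

(** Truncating the Fourier series at order L leaves a banded Toeplitz matrix.
    The circulant with the same coefficients has at (j, l) the sum of the c_i
    with j - l congruent to i modulo n, so it differs from the band only where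
    |j - l| >= n - L, that is, in two corners of size L.  The entries there are
    at most the sum of the |c_i|, whence a Frobenius bound free of n. *)
Lemma toeplitz_split f (d : R) : wiener f -> 0 < d ->
  exists (k : nat) (K : R), forall n, (k < n)%N ->
  exists (s : 'rV[C]_n) (Rc E : 'M[C]_n),
    [/\ toeplitz f n = udiag (fourier_mx n) s + Rc + E, (\rank Rc <= k)%N,
        frobenius_norm Rc ^+ 2 <= K & opbound E d].
Proof.
move=> [_ _ fl1] d0.
have [L tail] := esum_tail (fun k => cabs_ge0 (fourier f k)) fl1 d0.
pose W := \sum_(i < L.*2.+1) cabs (fourier f (i%:Z - L%:Z)).
have W0 : 0 <= W by apply: sumr_ge0 => i _; exact: cabs_ge0.
exists (2 * L)%N, ((2 * L)%:R * ((2 * L)%:R * W ^+ 2)) => n Ln.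
have n0 : (0 < n)%N by exact: leq_ltn_trans Ln.
pose c (i : 'I_L.*2.+1) : C := fourier f (i%:Z - L%:Z).
pose s : 'rV[C]_n := \row_m \sum_i c i * cis (- (2 * pi * m%:R * (i%:Z - L%:Z)%:~R / n%:R)).
pose band : 'M[C]_n := \matrix_(j, l) \sum_i c i * (j%:Z - l%:Z == i%:Z - L%:Z)%:R.
have bandE j l : band j l = if (`|j%:Z - l%:Z| <= L)%N then fourier f (j%:Z - l%:Z) else 0.
  rewrite mxE; case: ifPn => [le|gt]; last first.
    apply: big1 => i _; case: eqP => [e|_]; last by rewrite mulr0.
    by move: gt; rewrite e; have := ltn_ord i; lia.
  have iL : (absz (j%:Z - l%:Z + L%:Z)%R < L.*2.+1)%N by lia.
  rewrite (bigD1 (Ordinal iL)) //= big1 ?addr0 => [|i ij].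
    have -> : (absz (j%:Z - l%:Z + L%:Z))%:Z - L%:Z = j%:Z - l%:Z by lia.
    by rewrite eqxx mulr1 /c /=; congr fourier; lia.
  case: eqP => [e|_]; last by rewrite mulr0.
  by move: ij; rewrite -(inj_eq val_inj) /=; lia.
have circE j l : udiag (fourier_mx n) s j l =
    \sum_i c i * ((n%:Z %| j%:Z - l%:Z - (i%:Z - L%:Z))%Z)%:R.
  rewrite udiag.unlock circulantE.
  have -> : \sum_m s ord0 m * cis (2 * pi * m%:R * (j%:Z - l%:Z)%:~R / n%:R) =
    \sum_i \sum_(m < n) c i * cis (2 * pi * m%:R * (j%:Z - l%:Z - (i%:Z - L%:Z))%:~R / n%:R).
    rewrite exchange_big; apply: eq_bigr => m _; rewrite mxE mulr_suml.
    apply: eq_bigr => i _; rewrite -mulrA -cisD; congr (_ * cis _).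
    by rewrite [in RHS]intrB; ring.
  rewrite mulr_sumr; apply: eq_bigr => i _; rewrite -mulr_sumr sum_cis // mulrCA.
  congr (_ * _); case: ifP => _; last by rewrite mulr0.
  by rewrite -(rmorph_nat rc) -rmorphM /= mulVf ?rmorph1 // pnatr_eq0 -lt0n.
pose J := [set i : 'I_n | (i < L)%N || (n <= i + L)%N]%SET.
have JL : (#|J| <= 2 * L)%N by apply: card_corner; lia.
pose Rc := band - udiag (fourier_mx n) s.
have RcE j l : Rc j l = \sum_i c i * ((j%:Z - l%:Z == i%:Z - L%:Z)%:R -
     ((n%:Z %| j%:Z - l%:Z - (i%:Z - L%:Z))%Z)%:R).
  rewrite /Rc mxE [X in _ + X]mxE circE mxE -sumrB.
  by apply: eq_bigr => i _; rewrite mulrBr.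
have Rc0 j l : (j \notin J) || (l \notin J) -> Rc j l = 0.
  move=> jl; rewrite RcE big1 // => i _; case: eqP => [->|ne].
    by rewrite subrr dvdz0 subrr mulr0.
  have [nd|_] := boolP (_ %| _)%Z; last by rewrite subr0 mulr0.
  move: jl; rewrite !finset.inE !negb_or -!leqNgt -!ltnNge.
  have := ltn_ord i; have := ltn_ord j; have := ltn_ord l.
  move: nd ne; rewrite dvdzE /=.
  have [e|pos] := posnP (absz (j%:Z - l%:Z - (i%:Z - L%:Z))%R); first by lia.
  by move=> /(dvdn_leq pos); lia.
have RcW j l : cabs (Rc j l) <= W.
  rewrite RcE; apply: le_trans (cabs_sum _ _ _) _; apply: ler_sum => i _.
  rewrite cabsM ler_piMr ?cabs_ge0 //.
  case: eqP => [->|_]; first by rewrite subrr dvdz0 subrr cabs0.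
  rewrite add0r cabsN; case: (_ %| _)%Z; last by rewrite cabs0.
  by rewrite cabs1.
exists s, Rc, (toeplitz f n - band); split.
- by rewrite /Rc [udiag _ _ + _]addrC subrK addrC subrK.
- apply: leq_trans JL; apply: mxrank_row_support => j l jJ.
  by apply: Rc0; rewrite jJ.
- rewrite frobenius_sqr (bigID (mem J)) /= [X in _ + X]big1 ?addr0; last first.
    by move=> j jJ; apply: big1 => l _; rewrite Rc0 ?jJ // cabs0 expr0n.
  have row j : \sum_l cabs (Rc j l) ^+ 2 <= (2 * L)%:R * W ^+ 2.
    rewrite (bigID (mem J)) /= [X in _ + X]big1 ?addr0; last first.
      by move=> l lJ; rewrite Rc0 ?lJ ?orbT // cabs0 expr0n.
    apply: le_trans (_ : \sum_(l in J) W ^+ 2 <= _).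
      by apply: ler_sum => l _; apply: lerXn2r; rewrite ?nnegrE ?cabs_ge0.
    by rewrite sumr_const -[leLHS]mulr_natl ler_wpM2r ?sqr_ge0 // ler_nat.
  apply: le_trans (ler_sum _ (fun j _ => row j)) _.
  rewrite sumr_const -[leLHS]mulr_natl ler_wpM2r ?ler_nat //.
  by rewrite mulr_ge0 // sqr_ge0.
- have EE j l : cabs ((toeplitz f n - band) j l) =
      if (L < `|j%:Z - l%:Z|)%N then cabs (fourier f (j%:Z - l%:Z)) else 0.
    rewrite mxE [X in _ + X]mxE bandE mxE ltnNge; case: ifP => _.
      by rewrite subrr cabs0.
    by rewrite subr0.
  apply: opbound_schur => [|j|l]; first exact: ltW.
    under eq_bigr do rewrite EE; rewrite -big_mkcond.
    by apply: (tail _ _ (fun l : 'I_n => j%:Z - l%:Z)) => // l1 l2 /= e; apply: val_inj => /=; lia.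
  under eq_bigr do rewrite EE; rewrite -big_mkcond.
  by apply: (tail _ _ (fun j : 'I_n => j%:Z - l%:Z)) => // l1 l2 /= e; apply: val_inj => /=; lia.
Qed.
End ToeplitzSplitting.

(** * Power series of matrices *)

Section GeometricDomination.
Context {R : realType}.
Local Notation C := (Cplx R).

Definition geom_tail (B q : R) m : R := B * q ^+ m / (1 - q).

Lemma geom_tail_sum (B q : R) m p : 0 <= B -> 0 <= q -> q < 1 -> (m <= p)%N ->
  \sum_(m <= k < p) B * q ^+ k <= geom_tail B q m.
Proof.
move=> B0 q0 q1 /subnK <-; elim: (p - m)%N => [|k IH].
  by rewrite big_geq // /geom_tail divr_ge0 ?mulr_ge0 ?exprn_ge0 // subr_ge0 ltW.
suff : forall k, \sum_(m <= i < k + m) B * q ^+ i = B * (q ^+ m - q ^+ (k + m)) / (1 - q).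
  move=> ->; rewrite /geom_tail ler_pM2r ?invr_gt0 ?subr_gt0 // ler_wpM2l //.
  by rewrite gerBl exprn_ge0.
elim=> [|j IHj]; first by rewrite big_geq // subrr mulr0 mul0r.
rewrite addSn big_nat_recr ?leq_addl //= IHj exprS.
by field; rewrite subr_eq0 gt_eqF.
Qed.

Lemma geom_tail_small (B q e : R) : 0 <= q -> q < 1 -> 0 < e ->
  exists m0, forall m, (m0 <= m)%N -> geom_tail B q m < e.
Proof.
move=> q0 q1 e0.
have : geometric (B / (1 - q)) q @ \oo --> 0.
  by apply: cvg_geometric; rewrite ger0_norm.
move=> /cvgrPdist_lt /(_ e e0) [m0 _ m0P]; exists m0 => m /m0P.
rewrite /= sub0r normrN; apply: le_lt_trans; apply: le_trans (ler_norm _).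
by rewrite /geom_tail mulrAC.
Qed.

Lemma series_geom_real (v : nat -> R) (B q : R) : 0 <= B -> 0 <= q -> q < 1 ->
  (forall k, `|v k| <= B * q ^+ k) ->
  exists l, forall m, `|l - \sum_(0 <= k < m) v k| <= geom_tail B q m.
Proof.
move=> B0 q0 q1 vB.
have cv : cvgn (series v).
  apply: normed_cvg; apply: (@series_le_cvg _ _ (geometric B q)) => //=.
    by move=> k; rewrite mulr_ge0 ?exprn_ge0.
  by apply: is_cvg_geometric_series; rewrite ger0_norm.
exists (limn (series v)) => m.
have cm : (fun p => `|series v p - series v m|) @ \oo --> `|limn (series v) - series v m|.
  by apply: cvg_norm; apply: cvgB => //; exact: cvg_cst.
apply: (cvgr_to_le cm); exists m => // p /= mp.
rewrite /series /= [X in X - _](big_cat_nat (leq0n m) mp) /= addrAC subrr add0r.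
apply: le_trans (ler_norm_sum _ _ _) _; apply: le_trans (geom_tail_sum B0 q0 q1 mp).
by apply: ler_sum => k _.
Qed.

Lemma series_geom (u : nat -> C) (B q : R) : 0 <= B -> 0 <= q -> q < 1 ->
  (forall k, cabs (u k) <= B * q ^+ k) ->
  exists l : C, forall m, cabs (l - \sum_(0 <= k < m) u k) <= 2 * geom_tail B q m.
Proof.
move=> B0 q0 q1 uB.
have [|lr lrP] := @series_geom_real (fun k => complex.Re (u k)) B q B0 q0 q1.
  by move=> k; apply: le_trans (uB k); exact: Re_le_cabs.
have [|li liP] := @series_geom_real (fun k => complex.Im (u k)) B q B0 q0 q1.
  by move=> k; apply: le_trans (uB k); exact: Im_le_cabs.
exists (lr +i* li) => m; apply: le_trans (cabs_le_ReIm _) _.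
have -> : \sum_(0 <= k < m) u k =
    (\sum_(0 <= k < m) complex.Re (u k)) +i* (\sum_(0 <= k < m) complex.Im (u k)).
  elim: m => [|m IH]; first by rewrite !big_geq.
  by rewrite !big_nat_recr //= IH; case: (u m).
by rewrite /= mulr_natl mulr2n lerD.
Qed.
End GeometricDomination.

Section MatrixPowerSeries.
Context {R : realType}.
Local Notation C := (Cplx R).

(** The norm topology on complex matrices is the entrywise one; the real radius
    e stands for the positive complex radii. *)
Lemma cvg_mx_entries n (S : nat -> 'M[C]_n) (H : 'M[C]_n) :
  (forall e : R, 0 < e -> exists m0, forall m, (m0 <= m)%N ->
     forall i j, cabs (H i j - S m i j) < e) -> S @ \oo --> H.
Proof.
move=> SH; apply/cvg_ballP => e e0.
have eR : rc (complex.Re e) = e by rewrite /rc RRe_real // gtr0_real.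
have e0' : 0 < complex.Re e by rewrite -rc_lt eR rmorph0.
have [m0 m0P] := SH _ e0'; exists m0 => // m /m0P lt.
split=> // i j; rewrite -ball_normE /= normcR -eR rc_lt.
exact: lt.
Qed.

Lemma mxfun_limit (a : nat -> C) n (X H : 'M[C]_n) :
  series (fun k => a k *: X ^+ k) @ \oo --> H -> mxfun a X = H.
Proof. by move=> cv; apply: cvg_lim cv; exact: norm_hausdorff. Qed.

(** Convergence of the entries identifies h(X) as a limit, but passing from
    entries to the operator norm costs a factor n.  The dimension-free bound comes from comparing with a far
    partial sum: the blocks in between are bounded term by term in operator
    norm, and the entrywise remainder can be made as small as desired. *)
Lemma mxfun_truncation (a : nat -> C) (rho B q : R) n (X : 'M[C]_n) m :
  0 <= rho -> 0 <= B -> 0 <= q -> q < 1 ->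
  (forall k, cabs (a k) * rho ^+ k <= B * q ^+ k) -> opbound X rho ->
  opbound (mxfun a X - \sum_(0 <= k < m) a k *: X ^+ k) (geom_tail B q m).
Proof.
move=> rho0 B0 q0 q1 aB Xrho.
have akX k : opbound (a k *: X ^+ k) (B * q ^+ k).
  apply: opbound_le (aB k) _; apply: opboundZ; exact: opboundX.
have entry i j : exists l : C, forall p,
    cabs (l - \sum_(0 <= k < p) (a k *: X ^+ k) i j) <= 2 * geom_tail B q p.
  by apply: series_geom => // k; apply: cabs_entry_le.
have [H HP] : exists H : 'M[C]_n, forall i j p,
    cabs (H i j - (\sum_(0 <= k < p) (a k *: X ^+ k)) i j) <= 2 * geom_tail B q p.
  have [h hP] := choice (fun ij : 'I_n * 'I_n => entry ij.1 ij.2).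
  exists (\matrix_(i, j) h (i, j)) => i j p; rewrite mxE summxE.
  exact: (hP (i, j)).
have small (e : R) : 0 < e -> exists m0, forall p, (m0 <= p)%N ->
    forall i j, cabs (H i j - (\sum_(0 <= k < p) (a k *: X ^+ k)) i j) < e.
  move=> e0; have [|m0 m0P] := @geom_tail_small _ B q (e / 2) q0 q1; first by rewrite divr_gt0.
  exists m0 => p /m0P lt i j; apply: le_lt_trans (HP i j p) _.
  by rewrite mulrC -ltr_pdivlMr.
have -> : mxfun a X = H by apply: mxfun_limit; exact: cvg_mx_entries small.
have approx (e : R) : 0 < e ->
    opbound (H - \sum_(0 <= k < m) a k *: X ^+ k) (e + geom_tail B q m).
  move=> e0; have en0 : 0 < e / n.+1%:R by rewrite divr_gt0.
  have [m0 m0P] := small _ en0; pose p := maxn m0 m.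
  have mp : (m <= p)%N by exact: leq_maxr.
  rewrite -(subrK (\sum_(0 <= k < p) a k *: X ^+ k) H) -addrA.
  apply: opboundD.
    apply: (@opbound_le _ _ _ _ (n%:R * (e / n.+1%:R))).
      by rewrite mulrCA ger_pMr // ler_pdivrMr // mul1r ler_nat.
    apply: opbound_entries; first exact: ltW.
    move=> i j; rewrite mxE [X in _ + X]mxE; apply: ltW; apply: m0P; exact: leq_maxl.
  rewrite [X in X - _](big_cat_nat (leq0n m) mp) /= addrAC subrr add0r.
  apply: opbound_le (geom_tail_sum B0 q0 q1 mp) _.
  by apply: opbound_sum => k _.
move=> x; apply/ler_addgt0Pr => e e0.
have x1 : 0 < l2_norm x + 1 by rewrite ltr_wpDl ?l2_norm_ge0.
apply: le_trans (approx (e / (l2_norm x + 1)) _ x) _; first by rewrite divr_gt0.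
rewrite mulrDl addrC lerD2l -mulrA ger_pMr // mulrC ler_pdivrMr // mul1r lerDl.
exact: ler01.
Qed.

(** If the series converges at some z with |z| > rho, the terms a_k z^k are
    bounded, and q = rho / |z| works. *)
Lemma conv_radius_dominated (a : nat -> C) (rho : R) : 0 < rho ->
  (rho%:E < conv_radius a)%E ->
  exists B q, [/\ 0 <= B, 0 <= q, q < 1 & forall k, cabs (a k) * rho ^+ k <= B * q ^+ k].
Proof.
move=> rho0 /ereal_sup_gt[_ [z cz <-]]; rewrite lte_fin => rz.
have z0 : 0 < cabs z by exact: lt_trans rz.
have : (fun k => a k * z ^+ k) @ \oo --> (0 : C) by exact: cvg_series_cvg_0 cz.
move=> /cvgrPdist_lt /(_ 1 ltr01) [N _ NP].
pose b k := cabs (a k * z ^+ k).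
have b0 k : 0 <= b k by exact: cabs_ge0.
(* The terms from N on are at most 1, the earlier ones are finitely many. *)
pose B := 1 + \sum_(k < N) b k.
have S0 : 0 <= \sum_(k < N) b k by apply: sumr_ge0.
have bB k : b k <= B.
  have [kN|Nk] := ltnP k N.
    rewrite /B (bigD1 (Ordinal kN)) //= addrCA lerDl addr_ge0 // sumr_ge0 //.
  have := NP k Nk; rewrite /= sub0r normrN normcR -(rmorph1 rc) rc_lt => /ltW lt.
  by apply: le_trans lt _; rewrite lerDl.
exists B, (rho / cabs z); split.
- by rewrite addr_ge0.
- by rewrite divr_ge0 // ltW.
- by rewrite ltr_pdivrMr // mul1r.
move=> k; have := bB k; rewrite /b cabsM cabsX => le.
rewrite expr_div_n mulrA ler_pdivlMr ?exprn_gt0 // mulrAC.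
by rewrite ler_wpM2r // exprn_ge0 // ltW.
Qed.
End MatrixPowerSeries.

(** * Power series with real coefficients on real symbols *)

Section RealUnitaryDiagonal.
Context {R : realType} {n : nat}.
Local Notation C := (Cplx R).
Variable U : 'M[C]_n.
Hypothesis UJU : U^t* *m U = 1%:M.

Definition rudiag (h : 'I_n -> R) : 'M[C]_n := udiag U (\row_i rc (h i)).

Lemma rudiag1 : rudiag (fun=> 1) = 1%:M.
Proof. by rewrite -(udiag1 UJU) /rudiag; congr udiag; apply/rowP => i; rewrite !mxE rmorph1. Qed.

Lemma rudiagM g h : rudiag g *m rudiag h = rudiag (fun i => g i * h i).
Proof. by rewrite udiagM //; congr udiag; apply/rowP => i; rewrite !mxE rmorphM. Qed.

Lemma rudiagD g h : rudiag g + rudiag h = rudiag (fun i => g i + h i).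
Proof. by rewrite -udiagD //; congr udiag; apply/rowP => i; rewrite !mxE rmorphD. Qed.

Lemma rudiagJ h : (rudiag h)^t* = rudiag h.
Proof. by rewrite udiagJ //; congr udiag; apply/rowP => i; rewrite !mxE conj_rc. Qed.

Lemma rudiagZ (c : R) h : rc c *: rudiag h = rudiag (fun i => c * h i).
Proof.
have cM : rudiag (fun=> c) = rc c *: 1%:M.
  apply: (fconj_inj UJU); rewrite fconj_udiag // fconjE -scalemxAr -scalemxAl mulmx1.
  rewrite (mulmx1C UJU); apply/matrixP => i j; rewrite !mxE.
  by case: eqP => _; rewrite ?mulr1 ?mulr0.
by rewrite -rudiagM cM -scalemxAl mul1mx.
Qed.

Lemma rudiag_partial_sum (a : nat -> C) h m : (forall k, a k \is Num.real) ->
  exists g, \sum_(0 <= k < m) a k *: rudiag h ^+ k = rudiag g.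
Proof.
move=> ar; have pw k : exists g, rudiag h ^+ k = rudiag g.
  elim: k => [|k [g IH]]; first by exists (fun=> 1); rewrite expr0 rudiag1.
  by exists (fun i => h i * g i); rewrite exprS IH -rudiagM.
elim: m => [|m [g IH]].
  (* The empty sum is 0 times the identity. *)
  exists (fun=> 0 * 1); rewrite big_geq // -rudiagZ rmorph0 scale0r //.
have [g' pm] := pw m; have am : a m = rc (complex.Re (a m)) by rewrite /rc RRe_real.
exists (fun i => g i + complex.Re (a m) * g' i).
by rewrite big_nat_recr //= IH pm am rudiagZ rudiagD.
Qed.

Lemma rudiag_inv h : (forall i, h i != 0) ->
  rudiag h \in unitmx /\ invmx (rudiag h) = rudiag (fun i => (h i)^-1).
Proof.
move=> h0; have [|hu hi] := @udiag_inv _ _ U UJU (\row_i rc (h i)).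
  by move=> i; rewrite mxE -(rmorph0 rc) (inj_eq rc_inj).
split=> //; rewrite hi; congr udiag; apply/rowP => i.
by rewrite !mxE fmorphV.
Qed.

Lemma le_l2_norm_rudiag h i : `|h i| <= l2_norm (rudiag h *m (U^t* *m delta_mx i ord0)).
Proof.
have -> : rudiag h *m (U^t* *m delta_mx i ord0) =
    U^t* *m col i (diag_mx (\row_i rc (h i))).
  rewrite colE -(fconj_udiag UJU) fconjE !mulmxA -/(rudiag h).
  by rewrite UJU mul1mx.
rewrite l2_normUJ //; apply: le_trans (cabs_le_l2_norm _ i).
by rewrite !mxE eqxx mulr1n cabs_rc.
Qed.

Lemma opbound_rudiag h c : 0 <= c -> (forall i, `|h i| <= c) -> opbound (rudiag h) c.
Proof. by move=> c0 hc; apply: opbound_udiag => // i; rewrite mxE cabs_rc. Qed.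

(** The partial sums are real diagonal in the basis given by U, and the entries
    of h in that basis are approximated by theirs to any precision: off the
    diagonal they vanish, and on it their imaginary parts vanish. *)
Lemma mxfun_rudiag (a : nat -> C) (rho B q : R) h :
  (forall k, a k \is Num.real) -> 0 <= rho -> 0 <= B -> 0 <= q -> q < 1 ->
  (forall k, cabs (a k) * rho ^+ k <= B * q ^+ k) -> opbound (rudiag h) rho ->
  exists g, mxfun a (rudiag h) = rudiag g.
Proof.
move=> ar rho0 B0 q0 q1 aB hrho; set X := mxfun a (rudiag h).
have near (e : R) : 0 < e -> exists g, forall i j,
    cabs (fconj U X i j - diag_mx (\row_i rc (g i)) i j) < e.
  move=> e0; have [m /(_ m (leqnn m)) me] := geom_tail_small B q0 q1 e0.
  have [g pm] := rudiag_partial_sum h m ar.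
  exists g => i j; apply: le_lt_trans me.
  have := mxfun_truncation m rho0 B0 q0 q1 aB hrho.
  rewrite pm => /(opbound_fconj UJU) /(cabs_entry_le i j).
  by rewrite fconjB fconj_udiag // mxE [X in _ + X]mxE.
exists (fun i => complex.Re (fconj U X i i)).
apply: (fconj_inj UJU); rewrite fconj_udiag //; apply/matrixP => i j.
rewrite mxE; case: eqP => [<-|/eqP ij].
  rewrite mulr1n mxE; suff im0 : complex.Im (fconj U X i i) = 0.
    by case: (fconj U X i i) im0 => x y /= ->.
  apply/eqP; rewrite -normr_le0; apply/ler_addgt0Pr => e /near[g gP].
  rewrite add0r; apply: le_trans (ltW (gP i i)).
  apply: le_trans (Im_le_cabs _); rewrite cImD !mxE eqxx mulr1n.
  by rewrite cImN subr0.
apply/eqP; rewrite mulr0n -cabs_eq0 eq_le cabs_ge0 andbT.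
apply/ler_addgt0Pr => e /near[g gP].
have := gP i j; rewrite [X in _ - X]mxE (negPf ij) mulr0n subr0 add0r.
exact: ltW.
Qed.

End RealUnitaryDiagonal.

Section PowerSeriesDifference.
Context {R : realType}.
Local Notation C := (Cplx R).

(** Both truncation errors are small; the difference of the partial sums is
    treated power by power. *)
Lemma mxfun_lowrank_near (a : nat -> C) (rho B q e : R) n (A T : 'M[C]_n) m k :
  0 <= rho -> 0 <= B -> 0 <= q -> q < 1 -> 0 <= e ->
  (forall k, cabs (a k) * rho ^+ k <= B * q ^+ k) ->
  opbound A rho -> opbound T rho -> lowrank_near (A - T) k e ->
  lowrank_near (mxfun a A - mxfun a T) (\sum_(0 <= j < m) j * k)
    (2 * geom_tail B q m + \sum_(0 <= j < m) cabs (a j) * (j%:R * rho ^+ j.-1) * e).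
Proof.
move=> rho0 B0 q0 q1 e0 aB Arho Trho AT.
pose p (X : 'M[C]_n) := \sum_(0 <= j < m) a j *: X ^+ j.
have -> : mxfun a A - mxfun a T =
   ((mxfun a A - p A) - (mxfun a T - p T)) + (p A - p T).
  move: (mxfun a A) (mxfun a T) (p A) (p T) => x y z t.
  by rewrite opprB addrACA subrK (addrAC t) subrr sub0r.
apply: (@lowrank_nearD _ _ _ _ _ 0%N).
  apply: lowrank_near_small; rewrite mulr_natl mulr2n; apply: opboundD.
    exact: mxfun_truncation rho0 B0 q0 q1 aB Arho.
  by apply: opboundN; exact: mxfun_truncation rho0 B0 q0 q1 aB Trho.
rewrite /p -sumrB; apply: lowrank_near_sum => j _.
rewrite -scalerBr -mulrA; apply: lowrank_nearZ; exact: lowrank_nearX.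
Qed.
End PowerSeriesDifference.

(** * The preconditioned matrix *)

Section Assembly.
Context {R : realType}.
Local Notation C := (Cplx R).

Definition superoptimal_symbol n (A : 'M[C]_n) (i : 'I_n) : R :=
  rowsq (fconj (fourier_mx n) A) i / rdiag (fconj (fourier_mx n) A) i.

Section Symbol.
Variables (f : R -> R) (m M : R).
Hypothesis fW : wiener f.
Hypothesis m0 : 0 < m.
Hypothesis mf : forall t, m <= f t.
Hypothesis fM : forall t, f t <= M.

Let cf : continuous f. Proof. by case: fW. Qed.
Let M0 : 0 < M. Proof. exact: lt_le_trans m0 (le_trans (mf 0) (fM 0)). Qed.

Local Notation U := (@fourier_mx R).
Local Notation A := (toeplitz f).
Local Notation lam := (superoptimal_symbol (A _)).

Lemma superoptimal_toeplitz n (T : 'M[C]_n) : (0 < n)%N ->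
  superoptimal (A n) T -> T = rudiag (U n) lam.
Proof.
move=> n0 [[w ->] Tu Tmin].
have wE : (U n)^t* *m diag_mx w *m U n = udiag (U n) w by rewrite udiag.unlock.
rewrite wE in Tu Tmin *; rewrite /rudiag; congr udiag.
have UJU := @fourier_mxJK R n n0; have AJ := toeplitz_hermitian n cf.
have Am (x : 'cV[C]_n) := toeplitz_form_ge x cf mf.
have bii i := fconj_diag_real (U n) AJ i.
have b0 i : 0 < rdiag (fconj (U n) (A n)) i.
  exact: lt_le_trans m0 (fconj_diag_ge UJU Am i).
have vmin v : udiag (U n) v \in unitmx ->
    frobenius_norm (1%:M - invmx (udiag (U n) w) *m A n) <=
    frobenius_norm (1%:M - invmx (udiag (U n) v) *m A n).
  by move=> vu; apply: Tmin vu; exists v; rewrite udiag.unlock.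
exact: (superoptimal_udiag UJU bii b0 Tu vmin).
Qed.

Lemma superoptimal_symbol_bound n i : (0 < n)%N ->
  `|superoptimal_symbol (A n) i| <= M ^+ 2 / m.
Proof.
move=> n0; have UJU := @fourier_mxJK R n n0; have AJ := toeplitz_hermitian n cf.
have Am (x : 'cV[C]_n) := toeplitz_form_ge x cf mf.
rewrite ger0_norm.
  exact: (superoptimal_symbol_le UJU AJ m0 Am i (ltW M0) (opbound_toeplitz cf m0 mf fM)).
apply: divr_ge0; first by apply: sumr_ge0 => j _; rewrite sqr_ge0.
exact: le_trans (ltW m0) (fconj_diag_ge UJU Am i).
Qed.

Lemma toeplitz_lowrank_near (e : R) : 0 < e ->
  exists N k : nat, forall n, (N < n)%N ->
    lowrank_near (A n - rudiag (U n) (superoptimal_symbol (A n))) k e.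
Proof.
move=> e0.
have factor x : x + (2 * x + (2 * x) ^+ 2 / m) = x * (3 + 4 * x / m).
  by field; rewrite gt_eqF.
(* The error bound d + 2 d + (2 d)^2 / m is at most c d as soon as d <= 1. *)
pose c := 3 + 4 / m.
have c0 : 0 < c by rewrite addr_gt0 // divr_gt0.
pose d := Num.min 1 (e / c).
have d0 : 0 < d by rewrite lt_min ltr01 divr_gt0.
have d1 : d <= 1 by rewrite ge_min lexx.
have dc : d * c <= e by rewrite -ler_pdivlMr // ge_min lexx orbT.
have [k [K split]] := toeplitz_split fW d0.
pose q := Num.bound (`|K| / d ^+ 2).
exists k, (k + q)%N => n kn; have n0 : (0 < n)%N by exact: leq_ltn_trans kn.
have [s [Rc [E [AE rk fr Ed]]]] := split n kn.
have UJU := @fourier_mxJK R n n0; have AJ := toeplitz_hermitian n cf.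
have Am (x : 'cV[C]_n) := toeplitz_form_ge x cf mf.
have frq : frobenius_norm Rc ^+ 2 <= q%:R * d ^+ 2.
  apply: le_trans fr _; apply: le_trans (ler_norm K) _.
  rewrite -ler_pdivrMr ?exprn_gt0 //; apply: ltW; apply: archi_boundP.
  by rewrite divr_ge0 // ltW // exprn_gt0.
have := superoptimal_lowrank_near UJU AJ m0 Am AE d0 Ed rk frq.
apply: lowrank_near_le => //.
apply: le_trans dc.
rewrite factor ler_pM2l // lerD2l ler_pM2r ?invr_gt0 //.
by rewrite ler_piMr.
Qed.
End Symbol.

Lemma circ_abs_rudiag n (g : 'I_n -> R) : (0 < n)%N ->
  circ_abs (rudiag (fourier_mx n) g) = rudiag (fourier_mx n) (fun i => `|g i|).
Proof.
move=> n0; have UJU := @fourier_mxJK R n n0.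
have -> : forall C0 : 'M[C]_n, circ_abs C0 =
    udiag (fourier_mx n) (\row_j `|fconj (fourier_mx n) C0 j j|).
  by move=> C0; rewrite udiag.unlock fconj.unlock.
congr udiag; apply/rowP => j; rewrite !mxE fconj_udiag // !mxE eqxx mulr1n.
by rewrite normcR cabs_rc.
Qed.

(** Q is U^* diag(sgn g) U, the unitary factor in the polar decomposition of
    U^* diag(g) U; it is Hermitian because g is real. *)
Lemma absolute_value_preconditioning n (U : 'M[C]_n) (g : 'I_n -> R) (c : R) :
  U^t* *m U = 1%:M -> 0 <= c -> (forall i, g i != 0) -> (forall i, `|(g i)^-1| <= c) ->
  exists Q P : 'M[C]_n, [/\ P = invmx (rudiag U (fun i => `|g i|)),
    P *m rudiag U g = Q, Q \is hermsymmx, Q \is unitarymx & opbound P c].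
Proof.
move=> UJU c0 g0 gc.
have ng0 i : `|g i| != 0 by rewrite normr_eq0.
have [_ Pinv] := rudiag_inv UJU ng0.
exists (rudiag U (fun i => Num.sg (g i))), (rudiag U (fun i => `|g i|^-1)).
have QJ := rudiagJ UJU (fun i => Num.sg (g i)).
split=> //.
- rewrite rudiagM //; congr rudiag; apply/funext => i.
  by rewrite {2}[g i]numEsg mulrCA mulVf ?normr_eq0 // mulr1.
- by apply/is_hermitianmxP; rewrite expr0 scale1r.
- apply/unitarymxP; rewrite QJ rudiagM // -(rudiag1 UJU); congr rudiag.
  by apply/funext => i; rewrite -expr2 sqr_sg g0.
- by apply: opbound_rudiag => // i; rewrite -normfV normr_id.
Qed.
End Assembly.

Theorem corollary3p4 (R : realType)
  (a : nat -> Cplx R) (r : \bar R)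
  (a_real : forall k, a k \is Num.real)
  (r_gt0 : (0 < r)%E) (r_radius : conv_radius a = r)
  (f : R -> R) (fmax fmin : R)
  (f_wiener : wiener f) (f_pos : forall x, 0 < f x)
  (fmaxP : is_maximum f fmax) (fminP : is_minimum f fmin)
  (f_lt_r : ((fmax ^+ 2 / fmin)%:E < r)%E)
  (T : forall n : nat, 'M[Cplx R]_n)
  (T_superopt : forall n, (0 < n)%N -> superoptimal (toeplitz f n) (T n))
  (hT_bounded : exists c0 : R, forall n, (0 < n)%N ->
     mxfun a (T n) \in unitmx /\ spectral_norm (invmx (mxfun a (T n))) < c0) :
  forall eps : R, 0 < eps ->
  exists N M : nat, [/\ (0 < N)%N, (0 < M)%N &
    forall n : nat, (N < n)%N ->
    exists Q Rn E : 'M[Cplx R]_n,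
      [/\ invmx (circ_abs (mxfun a (T n))) *m mxfun a (toeplitz f n)
            = Q + Rn + E,
          Q \is hermsymmx /\ Q \is unitarymx,
          (\rank Rn <= 2 * M)%N
        & spectral_norm E <= eps]].
Proof.
move=> eps eps0.
have fracE (x y : R) : x != 0 -> y + 1 != 0 ->
    x * (y * (eps / (2 * x * (y + 1)))) = eps / 2 * (y / (y + 1)).
  by move=> x0 y0; field; rewrite x0 y0.
have [[xmin fxmin] minf] := fminP; have [_ fmaxf] := fmaxP.
have fmin0 : 0 < fmin by rewrite -fxmin.
have cf : continuous f by case: f_wiener.
have fmax0 : 0 < fmax by exact: lt_le_trans (f_pos 0) (fmaxf 0).
pose rho := fmax ^+ 2 / fmin.
have rho0 : 0 < rho by rewrite divr_gt0 // exprn_gt0.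
have fmax_rho : fmax <= rho.
  rewrite ler_pdivlMr // expr2 ler_pM2l //.
  exact: le_trans (minf 0) (fmaxf 0).
have [B [q [B0 q0 q1 aB]]] : exists B q, [/\ 0 <= B, 0 <= q, q < 1 &
    forall k, cabs (a k) * rho ^+ k <= B * q ^+ k].
  by apply: conv_radius_dominated => //; rewrite r_radius.
(* c bounds |h(T)|^-1; the added 1 keeps it positive. *)
have [c0 c0P] := hT_bounded; pose c : R := `|c0| + 1.
have c_gt0 : 0 < c by rewrite ltr_wpDl.
have [m /(_ m (leqnn m)) tail_m] := geom_tail_small B q0 q1 (divr_gt0 eps0 (mulr_gt0 (ltr0n _ 4) c_gt0)).
(* S bounds how much the m-th partial sum of h amplifies the error in A - T. *)
pose S := \sum_(0 <= j < m) cabs (a j) * (j%:R * rho ^+ j.-1).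
have S0 : 0 <= S.
  apply: sumr_ge0 => j _; rewrite mulr_ge0 ?cabs_ge0 // mulr_ge0 ?exprn_ge0 //.
  exact: ltW.
(* Half of eps is spent on the two truncation tails, half on A - T. *)
pose e := eps / (2 * c * (S + 1)).
have S1 : 0 < S + 1 by rewrite ltr_wpDl.
have e0 : 0 < e by rewrite divr_gt0 // !mulr_gt0.
have [N [k near]] := toeplitz_lowrank_near f_wiener fmin0 minf e0.
exists N.+1, (\sum_(0 <= j < m) j * k).+1%N; split=> // n Nn.
have n0 : (0 < n)%N by exact: leq_ltn_trans Nn.
have UJU := @fourier_mxJK R n n0.
have TE := superoptimal_toeplitz f_wiener fmin0 minf n0 (T_superopt n n0).
have Trho : opbound (T n) rho.
  rewrite TE; apply: opbound_rudiag => //; first exact: ltW.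
  by move=> i; apply: superoptimal_symbol_bound.
have Arho : opbound (toeplitz f n) rho.
  exact: opbound_le fmax_rho (opbound_toeplitz cf fmin0 minf fmaxf).
have [g hT] : exists g, mxfun a (T n) = rudiag (fourier_mx n) g.
  rewrite TE; apply: (mxfun_rudiag UJU a_real (ltW rho0) B0 q0 q1 aB).
  by rewrite -TE.
have [hTu hTc] := c0P n n0; rewrite hT in hTu hTc.
have g0 i : g i != 0.
  have := udiag_unit_neq0 UJU i hTu.
  by rewrite mxE -(rmorph0 rc) (inj_eq rc_inj).
have [_ ginv] := rudiag_inv UJU g0.
have gc i : `|(g i)^-1| <= c.
  apply: le_trans (le_l2_norm_rudiag UJU (fun i => (g i)^-1) i) _.
  rewrite -ginv; apply: le_trans (le_spectral_norm _ _) _.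
    by rewrite l2_normUJ // l2_norm_delta.
  by apply: le_trans (ltW hTc) _; rewrite (le_trans (ler_norm _)) // lerDl.
have [Q [P [PE PQ QH QU Pc]]] := absolute_value_preconditioning UJU (ltW c_gt0) g0 gc.
have diff : lowrank_near (toeplitz f n - T n) k e.
  by rewrite TE; apply: near; exact: ltnW.
have := mxfun_lowrank_near m (ltW rho0) B0 q0 q1 (ltW e0) aB Arho Trho diff.
move=> /(lowrank_nearMl (ltW c_gt0) Pc) [Rn [E [RE rk Ee]]].
exists Q, Rn, E; split=> //.
- rewrite hT circ_abs_rudiag // -PE -addrA -RE mulmxBr hT PQ addrC subrK.
  by [].
- exact: leq_trans rk (leq_trans (leqnSn _) (leq_pmull _ _)).
apply: spectral_norm_le; first exact: ltW.
apply: opbound_le Ee.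
rewrite -mulr_suml -/S.
have h1 : c * (2 * geom_tail B q m) <= eps / 2.
  move: tail_m; rewrite ltr_pdivlMr ?mulr_gt0 // => /ltW.
  move: (geom_tail B q m) => t; lra.
have h2 : c * (S * e) <= eps / 2.
  rewrite fracE ?gt_eqF //.
  rewrite ler_piMr ?divr_ge0 ?(ltW eps0) // ler_pdivrMr // mul1r lerDl.
  exact: ler01.
by rewrite mulrDr; apply: le_trans (lerD h1 h2) _; rewrite -splitr.
Qed.
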